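(* Let $0<\delta<1$ and $0<\rho<1$ be given. For each $d\in\mathbb{N}$ let $k=k(d)$ and $N=N(d)$ be integers with $0\le k<d<N-1$, such that $$\frac{d}{N}\to\delta,\qquad \frac{k}{d}\to\rho\qquad\text{as } d\to\infty.$$ For each $d$, let $\phi=\phi_d$ be a probability measure on $\mathbb{R}^{N-d-1}$ that is even (invariant under $x\mapsto -x$) and assigns measure zero to every hyperplane through the origin $o$. Let $G_{d,N}$ denote the (random class of combinatorially equivalent) polytope(s) in $\mathbb{R}^d$ associated with a $(\phi,N)$ random Gale diagram, and let $f_k(G_{d,N})$ be the number of its $k$-dimensional faces, with expectation $\mathbb{E} f_k(G_{d,N})$. Put $\rho_W(\delta):=\max\{0,2-\delta^{-1}\}$. Then $$\lim_{d\to\infty}\frac{\mathbb{E} f_k(G_{d,N})}{\binom{N}{k+1}}=\begin{cases}1 & \text{if }\rho<\rho_W(\delta),\\ 0 & \text{if }\rho>\rho_W(\delta).\end{cases}$$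
   Context: **Gale transform.** Let $(a_1,\dots,a_N)$ be a sequence of points affinely spanning $\mathbb{R}^d$. The space of affine dependences, i.e. of $(\lambda_1,\dots,\lambda_N)\in\mathbb{R}^N$ with $\sum_i\lambda_i a_i=o$ and $\sum_i\lambda_i=0$, has dimension $N-d-1$. Choose a basis of it and write the basis vectors as the rows of an $(N-d-1)\times N$ matrix. The sequence $(\overline a_1,\dots,\overline a_N)$ of columns of this matrix (vectors in $\mathbb{R}^{N-d-1}$) is a Gale transform of $(a_1,\dots,a_N)$. Conversely, any sequence $(\overline a_1,\dots,\overline a_N)$ linearly spanning $\mathbb{R}^{N-d-1}$ with $\overline a_1+\dots+\overline a_N=o$ is a Gale transform of some (non-unique) sequence of points in $\mathbb{R}^d$. **Random Gale diagram.** A $(\phi,N)$ random Gale diagram is a sequence $(X_1,\dots,X_N)$ of independent random vectors in $\mathbb{R}^{N-d-1}$ with distribution $\phi$, under the condition that $o\in\operatorname{conv}\{X_1,\dots,X_N\}$. That is, its law is that of an i.i.d. sequence $(Y_1,\dots,Y_N)$ with distribution $\phi$, conditioned on the event $o\in\operatorname{conv}\{Y_1,\dots,Y_N\}$. **The polytope $G_{d,N}$.** Almost surely $X_1,\dots,X_N$ are in linearly general position (any at most $N-d-1$ of them are linearly independent) and $o\in\operatorname{int}\operatorname{conv}\{X_1,\dots,X_N\}$. Hence there are $\lambda_1,\dots,\lambda_N>0$ such that $(\overline a_1,\dots,\overline a_N)=(\lambda_1X_1,\dots,\lambda_NX_N)$ satisfies $\overline a_1+\dots+\overline a_N=o$.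 Then $(\overline a_1,\dots,\overline a_N)$ is a Gale transform of a sequence $(a_1,\dots,a_N)$ in $\mathbb{R}^d$, and $G_{d,N}:=\operatorname{conv}\{a_1,\dots,a_N\}$. The polytope $G_{d,N}$ is not uniquely determined by $(X_1,\dots,X_N)$, but all possible choices are combinatorially isomorphic, so the number $f_k(G_{d,N})$ of $k$-dimensional faces is a well-defined random variable depending only on $(X_1,\dots,X_N)$. *)

(* Defs.v *)
From HB Require Import structures.
From mathcomp Require Import all_boot all_order all_algebra finmap.
From mathcomp Require Import all_classical all_reals all_analysis.

Set Implicit Arguments.
Unset Strict Implicit.
Unset Printing Implicit Defensive.

Import Order.TTheory GRing.Theory Num.Theory.
Import numFieldNormedType.Exports.

Local Open Scope classical_set_scope.
Local Open Scope ring_scope.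

(* Matrices, hence the row vectors 'rV[R]_n standing for R^n, carry their
   Borel sigma-algebra.  A tuple of row vectors then carries the product
   sigma-algebra of the library. *)
HB.instance Definition _ (R : realType) (m n : nat) :=
  @isMeasurable.Build (sigma_display (@open 'M[R]_(m, n))) 'M[R]_(m, n)
    <<s @open 'M[R]_(m, n) >>
    (@sigma_algebra0 _ setT open) (@sigma_algebraC _ open)
    (@sigma_algebra_bigcup _ setT open).

Section Convexity.
Context {R : realType}.

Definition dotmul {n : nat} (u v : 'rV[R]_n) : R := \sum_(i < n) u 0 i * v 0 i.

Definition conv_hull {n : nat} (A : set 'rV[R]_n) : set 'rV[R]_n :=
  smallest (@convex_set R 'rV[R]_n) A.

Definition affine_hull {n : nat} (A : set 'rV[R]_n) : set 'rV[R]_n :=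
  [set x | exists (m : nat) (p : 'I_m -> 'rV[R]_n) (c : 'I_m -> R),
    [/\ forall i, A (p i), \sum_i c i = 1 & x = \sum_i c i *: p i]].

(* The empty set has no dimension in this sense. *)
Definition has_affine_dim {n : nat} (A : set 'rV[R]_n) (k : nat) : Prop :=
  exists (x : 'rV[R]_n) (U : {vspace 'rV[R]_n}),
    \dim U = k /\ affine_hull A = [set x + u | u in [set` U]].

(* For u = 0 this includes the improper faces G and (if G is nonempty) set0. *)
Definition is_face {n : nat} (G F : set 'rV[R]_n) : Prop :=
  exists (u : 'rV[R]_n) (c : R),
    (forall x, G x -> dotmul u x <= c) /\ F = G `&` [set x | dotmul u x = c].

(* fset_set sends infinite sets to the empty finite set; this plays no role for
   polytopes, which have finitely many faces. *)
Definition num_faces {n : nat} (k : nat) (G : set 'rV[R]_n) : nat :=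
  #|` fset_set [set F | is_face G F /\ has_affine_dim F k] |.

End Convexity.

Section Gale.
Context {R : realType}.

Definition affine_dependence {d N : nat} (a : 'I_N -> 'rV[R]_d)
    (l : 'rV[R]_N) : Prop :=
  \sum_i l 0 i *: a i = 0 /\ \sum_i l 0 i = 0.

(* The matrix with columns abar_0, ..., abar_(N-1) has as rows a basis of the
   space of affine dependences of a; this forces n = N - d - 1. *)
Definition is_gale_transform {d N n : nat} (a : 'I_N -> 'rV[R]_d)
    (abar : 'I_N -> 'rV[R]_n) : Prop :=
  let M := \matrix_(r < n, i < N) abar i 0 r in
  [/\ affine_hull (range a) = setT,
      row_free M &
      forall l : 'rV[R]_N, (l <= M)%MS <-> affine_dependence a l].

Definition is_gale_polytope {d N n : nat} (x : N.-tuple 'rV[R]_n)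
    (G : set 'rV[R]_d) : Prop :=
  exists (l : 'I_N -> R) (a : 'I_N -> 'rV[R]_d),
    [/\ forall i, 0 < l i,
        \sum_i l i *: tnth x i = 0,
        is_gale_transform a (fun i => l i *: tnth x i) &
        G = conv_hull (range a)].

Definition origin_in_conv (N n : nat) : set (N.-tuple 'rV[R]_n) :=
  [set y | conv_hull (range (tnth y)) 0].

End Gale.

Section Probability.
Context {R : realType}.

Definition mutually_independent {d d' : measure_display} {T : measurableType d}
    {V : measurableType d'} (P : probability T R) {N : nat}
    (Y : 'I_N -> {RV P >-> V}) : Prop :=
  forall (J : {set 'I_N}) (B : 'I_N -> set V), (forall i, measurable (B i)) ->
    P (\bigcap_(i in [set` J]) (Y i @^-1` B i)) =
    (\prod_(i in J) P (Y i @^-1` B i))%E.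

(* X has the law of an i.i.d. sequence with distribution phi conditioned on the
   event that the origin lies in the convex hull. *)
Definition is_random_gale_diagram {N n : nat}
    (phi : probability 'rV[R]_n R) {d : measure_display} {T : measurableType d}
    (P : probability T R) (X : {RV P >-> N.-tuple 'rV[R]_n}) : Prop :=
  exists (d' : measure_display) (T' : measurableType d')
         (P' : probability T' R) (Y : 'I_N -> {RV P' >-> 'rV[R]_n}),
    let Yseq := fun t => [tuple Y i t | i < N] in
    [/\ mutually_independent Y,
        forall i (B : set 'rV[R]_n), measurable B ->
          distribution P' (Y i) B = phi B &
        forall A : set (N.-tuple 'rV[R]_n), measurable A ->
          distribution P X A =
          (P' (Yseq @^-1` (A `&` @origin_in_conv R N n)) /
           P' (Yseq @^-1` @origin_in_conv R N n))%E].

Definition even_measure {n : nat} (phi : probability 'rV[R]_n R) : Prop :=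
  forall B : set 'rV[R]_n, measurable B ->
    phi ((fun x => - x) @^-1` B) = phi B.

Definition null_on_linear_hyperplanes {n : nat}
    (phi : probability 'rV[R]_n R) : Prop :=
  forall u : 'rV[R]_n, u != 0 -> phi [set x | dotmul u x = 0] = 0%E.

Definition rho_W (delta : R) : R := Num.max 0 (2 - delta^-1).

End Probability.

(* Main.v *)
(* Let N = n + d + 1, with n the dimension of the Gale diagram.  By Gale duality and
   general position, the k-faces of the polytope correspond to the (k+1)-subsets I
   of the indices such that the X_i with i outside I are not all contained in an
   open half-space; conditioning on the whole sequence not being one-sided costs
   only a normalisation, since a sequence with a subsequence that is not one-sided
   is not one-sided either.

   Wendel's theorem: a generic n-dimensional subspace of R^m meets a fixed number of
   open orthants (an Euler-type recursion, cutting by one hyperplane at a time),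
   and evenness makes all sign patterns equally likely; hence m points are not
   one-sided with probability P(Bin(m - 1, 1/2) <= m - 1 - n).  The normalised
   expectation is therefore
     P(Bin(N - k - 2, 1/2) <= d - k - 1) / P(Bin(N - 1, 1/2) <= d).

   For delta > 1/2 both terms converge by Chebyshev's inequality.  For
   delta <= 1/2 the denominator may tend to 0 too, and the quotient is bounded by
   the product over i <= k of 2 (d - i) / (N - 1 - i), of which the second half of
   the factors decays exponentially. *)

Require Import Defs.
From HB Require Import structures.
From mathcomp Require Import all_boot all_order all_algebra finmap.
From mathcomp Require Import all_classical all_reals all_analysis.
From mathcomp Require Import measurable_realfun.
From mathcomp Require Import ring lra zify.

Import Order.TTheory GRing.Theory Num.Theory.
Import numFieldNormedType.Exports.

Local Open Scope classical_set_scope.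
Local Open Scope ring_scope.

(** * Sign patterns, general position and Gordan's alternative *)

Section Dotmul.
Context {R : realType} {n : nat}.
Implicit Types u v w y : 'rV[R]_n.

Lemma dotmulE u v : dotmul u v = (u *m v^T) 0 0.
Proof. by rewrite mxE; apply: eq_bigr => i _; rewrite mxE. Qed.

Lemma dotmulC u v : dotmul u v = dotmul v u.
Proof. by apply: eq_bigr => i _; rewrite mulrC. Qed.

Lemma dotmulDl u v w : dotmul (u + v) w = dotmul u w + dotmul v w.
Proof. by rewrite !dotmulE mulmxDl mxE. Qed.

Lemma dotmulZl (a : R) u w : dotmul (a *: u) w = a * dotmul u w.
Proof. by rewrite !dotmulE -scalemxAl mxE. Qed.

Lemma dotmulNl u w : dotmul (- u) w = - dotmul u w.
Proof. by rewrite -scaleN1r dotmulZl mulN1r. Qed.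

Lemma dotmul0l w : dotmul 0 w = 0.
Proof. by rewrite dotmulE mul0mx mxE. Qed.

Lemma dotmulDr u v w : dotmul w (u + v) = dotmul w u + dotmul w v.
Proof. by rewrite dotmulC dotmulDl !(dotmulC w). Qed.

Lemma dotmulZr (a : R) u w : dotmul w (a *: u) = a * dotmul w u.
Proof. by rewrite dotmulC dotmulZl dotmulC. Qed.

Lemma dotmulNr u w : dotmul w (- u) = - dotmul w u.
Proof. by rewrite dotmulC dotmulNl dotmulC. Qed.

Lemma dotmul0r w : dotmul w 0 = 0.
Proof. by rewrite dotmulC dotmul0l. Qed.

Lemma dotmul_sumr (I : Type) (s : seq I) (Q : pred I) (F : I -> 'rV[R]_n) w :
  dotmul w (\sum_(i <- s | Q i) F i) = \sum_(i <- s | Q i) dotmul w (F i).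
Proof.
exact: (big_morph _ (fun u v => dotmulDr u v w) (dotmul0r w)).
Qed.

Lemma dotmul_delta u (j : 'I_n) : dotmul u (delta_mx 0 j) = u 0 j.
Proof.
rewrite /dotmul (bigD1 j) //= mxE !eqxx mulr1 big1 ?addr0 // => i ij.
by rewrite mxE (negbTE ij) andbF mulr0.
Qed.

Lemma dotmul_eq0P u : (forall w, dotmul w u = 0) -> u = 0.
Proof.
by move=> u0; apply/rowP => j; rewrite -dotmul_delta dotmulC u0 mxE.
Qed.

End Dotmul.

Section SignPatterns.
Context {R : realType} {n : nat}.
Local Notation V := 'rV[R]_n.
Implicit Types (W : set V) (u v w y : V) (ys : seq V).

Definition pos_half y : set V := [set u | 0 < dotmul u y].
Definition orth y : set V := [set u | dotmul u y = 0].

(* The number of sign patterns (sign <u, y_i>)_i, all nonzero, realised by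
   points u of W. *)
Fixpoint npatterns W ys : nat :=
  if ys is y :: ys' then
    (npatterns (W `&` pos_half y) ys' + npatterns (W `&` pos_half (- y)) ys')%N
  else `[< W !=set0 >].

Definition segment_closed W : Prop :=
  forall u w (t : R), W u -> W w -> 0 <= t <= 1 -> W ((1 - t) *: u + t *: w).

(** Openness is asked only in the direction [v]: the sets cut below lie in subspaces such as
    [orths s], which need not be open. *)
Definition open_along v W : Prop :=
  forall u, W u -> exists2 e : R, 0 < e & forall t, `|t| < e -> W (u + t *: v).

Lemma segment_closed_pos_half W y :
  segment_closed W -> segment_closed (W `&` pos_half y).
Proof.
move=> cW u w t [Wu yu] [Ww yw] t01; split; first exact: cW.
rewrite /pos_half /= in yu yw *.
rewrite dotmulDl !dotmulZl; case/andP: t01 => t0 t1.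
have [->|tn0] := eqVneq t 0; first by rewrite subr0 mul1r mul0r addr0.
have h1 : 0 <= (1 - t) * dotmul u y by rewrite mulr_ge0 ?subr_ge0// ltW.
have h2 : 0 < t * dotmul w y by rewrite mulr_gt0// lt_neqAle eq_sym tn0.
lra.
Qed.

Lemma open_along_pos_half v W y :
  open_along v W -> open_along v (W `&` pos_half y).
Proof.
move=> oW u [Wu yu]; have [e e0 eW] := oW _ Wu.
rewrite /pos_half /= in yu.
pose b := `|dotmul v y| + 1; have b0 : 0 < b by rewrite ltr_wpDl.
exists (Num.min e (dotmul u y / b)).
  by rewrite lt_min e0 divr_gt0.
move=> t; rewrite lt_min => /andP[te tb]; split; first exact: eW.
rewrite /pos_half /= dotmulDl dotmulZl -ltrBlDr sub0r.
apply: le_lt_trans (ler_norm _) _; rewrite normrN normrM.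
apply: (@le_lt_trans _ _ (`|t| * b)).
  by rewrite ler_wpM2l// lerDl.
by rewrite -ltr_pdivlMr.
Qed.

Lemma npatterns0 ys : npatterns set0 ys = 0%N.
Proof.
elim: ys => [|y ys ih] /=; last by rewrite !set0I ih.
by case: asboolP => // -[].
Qed.

(** A cell of the arrangement [ys] either misses the hyperplane orthogonal to [y] and lies on one
    side of it, or meets it and then contributes one pattern on each side and one in the slice. Both
    closure conditions pass to half-spaces, so induction on [ys] reduces to a single cell. *)
Lemma npatterns_split W y v ys : segment_closed W -> open_along v W ->
  dotmul v y != 0 ->
  (npatterns (W `&` pos_half y) ys + npatterns (W `&` pos_half (- y)) ys =
   npatterns W ys + npatterns (W `&` orth y) ys)%N.
Proof.
move=> + + vy; elim: ys W => [|z ys ih] W cW oW; last first.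
  rewrite /= !(setIAC W _ (pos_half z)) !(setIAC W _ (pos_half (- z))).
  rewrite addnACA ih; [|exact: segment_closed_pos_half|exact: open_along_pos_half].
  rewrite ih; [|exact: segment_closed_pos_half|exact: open_along_pos_half].
  by rewrite addnACA.
rewrite /=; case: (asboolP (W `&` orth y !=set0)) => [[u [Wu uy]]|Wy0].
  (* The hyperplane meets the cell: pushing a common point both ways along [v] reaches both
     sides. *)
  rewrite /orth /= in uy; have [e e0 eW] := oW _ Wu.
  have e2 : `|e / 2| < e by rewrite gtr0_norm ?divr_gt0//; lra.
  have p1 : W (u + (e / 2) *: v) by exact: eW.
  have p2 : W (u + (- (e / 2)) *: v) by apply: eW; rewrite normrN.
  rewrite (@asboolT (W !=set0)); last by exists u.
  have d1 : dotmul (u + (e / 2) *: v) y = e / 2 * dotmul v y.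
    by rewrite dotmulDl dotmulZl uy add0r.
  have d2 : dotmul (u + (- (e / 2)) *: v) y = - (e / 2) * dotmul v y.
    by rewrite dotmulDl dotmulZl uy add0r.
  have [vy0|vy0] : 0 < dotmul v y \/ dotmul v y < 0.
    by move: vy; rewrite neq_lt => /orP[]; [right|left].
  - rewrite asboolT; last first.
      by exists (u + (e / 2) *: v); split => //; rewrite /pos_half /= d1; nra.
    rewrite asboolT//; exists (u + (- (e / 2)) *: v); split => //.
    by rewrite /pos_half /= dotmulNr d2; nra.
  - rewrite asboolT; last first.
      by exists (u + (- (e / 2)) *: v); split => //; rewrite /pos_half /= d2; nra.
    rewrite asboolT//; exists (u + (e / 2) *: v); split => //.
    by rewrite /pos_half /= dotmulNr d1; nra.
rewrite addn0; case: (asboolP (_ `&` pos_half y !=set0)) => [[u [Wu uy]]|W1].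
  rewrite (@asboolT (W !=set0)); last by exists u.
  rewrite asboolF ?addn0// => -[w [Ww]].
  rewrite /pos_half /= in uy *; rewrite dotmulNr oppr_gt0 => wy.
  apply: Wy0; set a := dotmul u y in uy; set b := dotmul w y in wy.
  have ab : 0 < a - b by lra.
  (* At this parameter the affine function with value [a] at [u] and [b] at [w] vanishes, so the
     segment would cross the hyperplane. *)
  exists ((1 - a / (a - b)) *: u + (a / (a - b)) *: w); split.
    apply: cW => //; rewrite divr_ge0 ?(ltW uy) ?(ltW ab)//=.
    by rewrite ler_pdivrMr// mul1r; lra.
  by rewrite /orth /= dotmulDl !dotmulZl -/a -/b; field; rewrite gt_eqF.
rewrite add0n; congr nat_of_bool; apply: asbool_equiv_eq; split=> [[u [Wu _]]|[u Wu]].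
  by exists u.
exists u; split => //; rewrite /pos_half /= dotmulNr oppr_gt0.
case: (ltgtP (dotmul u y) 0) => // uy; exfalso.
  by apply: W1; exists u.
by apply: Wy0; exists u.
Qed.

(* The number of open orthants of R^m met by a generic D-dimensional subspace. *)
Fixpoint schlafli (D m : nat) : nat :=
  if m is m'.+1 then
    if D is D'.+1 then (schlafli D m' + schlafli D' m')%N else 0%N
  else 1%N.

(** Both sides obey Pascal's recursion. The formula starts at [m.+1] because with no hyperplane the
    whole space counts as one pattern, even for [D = 0]. *)
Lemma schlafliE D m :
  schlafli D m.+1 = (2 * \sum_(i < D) 'C(m, i))%N.
Proof.
elim: m D => [|m ih] [|D]; rewrite ?big_ord0 ?muln0//.
  by rewrite big_ord_recl /= big1// => i _; rewrite bin_small.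
have -> : schlafli D.+1 m.+2 = (schlafli D.+1 m.+1 + schlafli D m.+1)%N by [].
rewrite (ih D.+1) (ih D) -mulnDr; congr (2 * _)%N.
rewrite !big_ord_recl !bin0 -addnA; congr (_ + _)%N.
by rewrite -big_split; apply: eq_bigr => i _; rewrite lift0 binS.
Qed.

End SignPatterns.

(** * Linear algebra and sign patterns of vectors in general position *)

Section GeneralPosition.
Context {R : realType} {n N : nat}.
Implicit Types (x : 'I_N -> 'rV[R]_n) (s t : seq 'I_N).

Definition general_position x : Prop :=
  forall s : n.-tuple 'I_N, uniq s -> \matrix_(i < n) x (tnth s i) \in unitmx.

Lemma extend_uniq s m : uniq s -> (size s <= m <= N)%N ->
  exists t : m.-tuple 'I_N, uniq t /\ {subset s <= t}.
Proof.
move=> us /andP[sm mN].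
pose r := [seq i <- enum 'I_N | i \notin s].
have usr : uniq (s ++ r).
  rewrite cat_uniq us filter_uniq ?enum_uniq// andbT /=.
  by apply/hasPn => i; rewrite mem_filter => /andP[].
have ssr : size (s ++ r) = N.
  rewrite -[RHS]card_ord cardE; apply/eqP; rewrite -uniq_size_uniq ?enum_uniq//.
  by move=> i; rewrite mem_enum mem_cat mem_filter mem_enum andbT; case: (i \in s).
have st : size (take m (s ++ r)) == m by rewrite size_takel// ssr.
exists (Tuple st); split; first exact: take_uniq.
move=> i si; rewrite memtE /= take_cat ltnNge sm /=.
by rewrite mem_cat si.
Qed.

Hypothesis nN : (n <= N)%N.
Variable x : 'I_N -> 'rV[R]_n.
Hypothesis gx : general_position x.

Lemma general_position_orth s u : uniq s -> (n <= size s)%N ->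
  {in s, forall i, dotmul u (x i) = 0} -> u = 0.
Proof.
move=> us ns u0; have st : size (take n s) == n by rewrite size_takel.
pose t := Tuple st.
have ut : uniq t by exact: take_uniq.
have := gx _ ut; set M := \matrix_i _ => MU.
have : M *m u^T = 0.
  apply/colP => i; rewrite !mxE; rewrite -[RHS](u0 (tnth t i)).
    by apply: eq_bigr => j _; rewrite !mxE mulrC.
  by have := mem_tnth i t; rewrite memtE; exact: mem_take.
move/(congr1 (mulmx (invmx M))); rewrite mulKmx// mulmx0 => /(congr1 trmx).
by rewrite trmxK trmx0.
Qed.

Lemma general_position_interp s (f : 'I_N -> R) : uniq s -> (size s <= n)%N ->
  exists v, {in s, forall i, dotmul v (x i) = f i}.
Proof.
move=> us sn; have [|t [ut st]] := @extend_uniq s n us; first by rewrite sn.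
have := gx _ ut; set M := \matrix_i _ => MU.
exists (invmx M *m \col_i f (tnth t i))^T => i /st /tnthP[j ->].
rewrite dotmulC dotmulE trmxK.
have -> : x (tnth t j) = row j M by apply/rowP => l; rewrite !mxE.
by rewrite -row_mul mulKVmx// !mxE.
Qed.

Lemma general_position_span s w : uniq s -> (n <= size s)%N ->
  exists c : 'I_N -> R, (forall i, i \notin s -> c i = 0) /\
    w = \sum_i c i *: x i.
Proof.
move=> us ns; have st : size (take n s) == n by rewrite size_takel.
pose t := Tuple st.
have ut : uniq t by exact: take_uniq.
have ts i : i \in t -> i \in s by rewrite memtE; exact: mem_take.
have := gx _ ut; set M := \matrix_i _ => MU.
pose b := w *m invmx M.
(* [b] holds the coordinates of [w] in the basis [x (tnth t r)]; summing over positions turns them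
   into coefficients on indices. *)
exists (fun i => \sum_(r < n | i == tnth t r) b 0 r); split.
  move=> i si; rewrite big1// => r /eqP ri; case/negP: si.
  by apply: ts; rewrite ri mem_tnth.
under eq_bigr do rewrite scaler_suml.
rewrite (exchange_big_dep predT) //=.
under eq_bigr do rewrite big_pred1_eq.
rewrite -[LHS](mulmxKV MU) -/b mulmx_sum_row; apply: eq_bigr => r _.
by congr (_ *: _); apply/rowP => l; rewrite !mxE.
Qed.

Definition orths s : set 'rV[R]_n := [set u | {in s, forall i, dotmul u (x i) = 0}].

(** Cutting at [x j] leaves the patterns of [js] on [orths s] and on its slice [orths (j :: s)], of
    one dimension less, which is the recursion of [schlafli]. *)
Lemma npatterns_general_position s js : uniq (s ++ js) -> (size s <= n)%N ->
  npatterns (orths s) (map x js) = schlafli (n - size s) (size js).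
Proof.
elim: js s => [|j js ih] s usj sn.
  by rewrite /= asboolT//; exists 0 => i _; rewrite dotmul0l.
have us : uniq s by move: usj; rewrite cat_uniq => /andP[].
have usj' : uniq (s ++ js).
  apply: subseq_uniq usj; apply: cat_subseq => //; exact: subseq_cons.
have ujs : uniq ((j :: s) ++ js) by rewrite -[_ ++ _]/([:: j] ++ s ++ js) uniq_catCA.
(* When [size s = n] the subspace is zero, so no strict sign is realised, in agreement with
   [schlafli 0 _.+1 = 0]. *)
have [E|sn'] := eqVneq (size s) n.
  rewrite E subnn /= (_ : orths s `&` _ = set0); last first.
    apply/seteqP; split => // u [us0]; rewrite /pos_half /=.
    by rewrite (general_position_orth _ _ us _ us0) ?E// dotmul0l ltxx.
  rewrite (_ : orths s `&` _ = set0) ?npatterns0//.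
  apply/seteqP; split => // u [us0]; rewrite /pos_half /=.
  by rewrite (general_position_orth _ _ us _ us0) ?E// dotmul0l ltxx.
have ltsn : (size s < n)%N by rewrite ltn_neqAle sn'.
(* A direction inside [orths s] and transversal to the hyperplane of [x j], as the cut requires. *)
have [||v vE] := @general_position_interp (j :: s) (fun i => (i == j)%:R).
- by move: ujs; rewrite cat_uniq => /andP[].
- by [].
have jns : j \notin s.
  by move: ujs; rewrite cat_uniq => /andP[/= /andP[]].
have vj : dotmul v (x j) = 1 by rewrite vE ?mem_head// eqxx.
have vs i : i \in s -> dotmul v (x i) = 0.
  move=> si; rewrite vE ?inE ?si ?orbT//; case: eqP => // ij.
  by rewrite -ij si in jns.
rewrite [LHS](@npatterns_split _ _ _ _ v); first last.
- by rewrite vj oner_neq0.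
- move=> u us0; exists 1 => // t _ i si.
  by rewrite dotmulDl dotmulZl us0// vs// mulr0 addr0.
- move=> u w t us0 ws0 _ i si.
  by rewrite dotmulDl !dotmulZl us0// ws0// !mulr0 addr0.
rewrite ih// (_ : orths s `&` orth (x j) = orths (j :: s)).
  by rewrite ih//= subnS; case: (n - size s)%N (subn_gt0 (size s) n) => //; rewrite ltsn.
apply/seteqP; split=> u.
  by move=> [us0 uj] i; rewrite inE => /predU1P[->//|]; exact: us0.
move=> us0; split; last by apply: us0; rewrite mem_head.
by move=> i si; apply: us0; rewrite inE si orbT.
Qed.

End GeneralPosition.

(** * Gordan's alternative *)

Section Gordan.
Context {R : realType} {n : nat} {I : eqType}.
Implicit Types (W : set 'rV[R]_n).

(* Gordan's alternative relative to a linear subspace W, by induction on the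
   number of vectors: if a solution on js is not positive at the new vector y_j,
   one restricts W to the orthogonal complement of y_j. *)
Lemma gordan_subspace (x : I -> 'rV[R]_n) (js : seq I) W : uniq js ->
  W 0 -> (forall (a : R) u v, W u -> W v -> W (a *: u + v)) ->
  (exists2 u, W u & {in js, forall i, 0 < dotmul u (x i)}) \/
  (exists c : I -> R, [/\ forall i, 0 <= c i, exists2 i, i \in js & 0 < c i &
    forall u, W u -> \sum_(i <- js) c i * dotmul u (x i) = 0]).
Proof.
elim: js W => [|j js ih] W /=; first by move=> _ W0 _; left; exists 0.
move=> /andP[jjs ujs] W0 lW.
have sumj (c : I -> R) (b : R) u : \sum_(i <- j :: js) (if i == j then b else c i) * dotmul u (x i) =
   b * dotmul u (x j) + \sum_(i <- js) c i * dotmul u (x i).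
  rewrite big_cons eqxx; congr (_ + _); rewrite !big_seq; apply: eq_bigr => i ij.
  by case: eqP => // ij'; rewrite -ij' ij in jjs.
case: (ih W ujs W0 lW) => [[u Wu upos]|[c [c0 [i0 i0js ci0] cW]]]; last first.
  right; exists (fun i => if i == j then 0 else c i); split.
  - by move=> i; case: ifP.
  - exists i0; first by rewrite inE i0js orbT.
    by case: eqP => // ij; rewrite -ij i0js in jjs.
  - by move=> u Wu; rewrite sumj mul0r add0r cW.
have [uj|uj] := ltP 0 (dotmul u (x j)).
  by left; exists u => // i; rewrite inE => /predU1P[->|/upos].
case: (ih (W `&` orth (x j)) ujs) => [||[w [Ww wj] wpos]|[c [c0 [i0 i0js ci0] cW]]].
- by split; rewrite // /orth /= dotmul0l.
- move=> a v w [Wv vj] [Ww wj]; split; first exact: lW.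
  by rewrite /orth /= in vj wj *; rewrite dotmulDl dotmulZl vj wj mulr0 addr0.
- have [vE|/existsNP[v /not_implyP[Wv vj]]] :=
    pselect (forall v, W v -> dotmul v (x j) = 0).
    right; exists (fun i => if i == j then 1 else 0); split.
    + by move=> i; case: ifP.
    + by exists j; rewrite ?mem_head ?eqxx.
    + move=> v Wv; rewrite (sumj (fun=> 0)) vE// mulr0 add0r.
      by rewrite big1// => i _; rewrite mul0r.
  left; move/eqP in vj.
  (* [w] vanishes at [x j], so the signed copy [v'] of [v] supplies positivity there; [K] is so
     large that [K *: w] still dominates it on [js]. *)
  pose K := \sum_(i <- js) `|dotmul v (x i)| / dotmul w (x i) + 1.
  have K1 : 0 < K.
    apply: ltr_wpDl => //; rewrite big_seq sumr_ge0// => i ij.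
    by rewrite divr_ge0// ltW// wpos.
  pose v' := (Num.sg (dotmul v (x j))) *: v.
  exists (K *: w + v'); first by apply: (lW) => //; rewrite -[v']addr0; exact: (lW).
  move=> i; rewrite inE => /predU1P[->|ij].
    rewrite dotmulDl dotmulZl wj mulr0 add0r dotmulZl -normrEsg.
    by rewrite normr_gt0.
  rewrite dotmulDl !dotmulZl.
  have wi := wpos _ ij.
  have : `|dotmul v (x i)| / dotmul w (x i) < K.
    rewrite /K (bigD1_seq i)//= -addrA ltrDl ltr_wpDl//.
    rewrite big_seq_cond sumr_ge0// => l /andP[lj _].
    by rewrite divr_ge0// ltW// wpos.
  rewrite ltr_pdivrMr// => h; rewrite -ltrBlDr sub0r; apply: le_lt_trans h.
  apply: le_trans (ler_norm _) _; rewrite normrN normrM.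
  by rewrite normr_sg vj mul1r.
(* The relation vanishes on the slice but is positive at [u], so [u] is outside the slice and
   [dotmul u (x j)] is strictly negative. *)
- have upos' : 0 < \sum_(i <- js) c i * dotmul u (x i).
    rewrite (bigD1_seq i0)//=; apply: ltr_pwDl; first by rewrite mulr_gt0// upos.
    by rewrite big_seq_cond sumr_ge0// => l /andP[lj _]; rewrite mulr_ge0// ltW// upos.
  have uj0 : dotmul u (x j) < 0.
    rewrite lt_neqAle uj andbT; apply/eqP => uj0.
    by move: upos'; rewrite cW ?ltxx//.
  (* The coefficient at [j] makes the relation vanish at [u] too; every vector of [W] is a multiple
     of [u] plus a vector of the slice. *)
  right; exists (fun i => if i == j then
     - (\sum_(i <- js) c i * dotmul u (x i)) / dotmul u (x j) else c i); split.
  + move=> i; case: ifP => // _.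
    by rewrite mulNr -mulrN mulr_ge0 ?ltW// oppr_gt0 invr_lt0.
  + exists i0; first by rewrite inE i0js orbT.
    by case: eqP => // ij; rewrite -ij i0js in jjs.
  + move=> v Wv; rewrite sumj.
    have : \sum_(i <- js) c i * dotmul (- (dotmul v (x j) / dotmul u (x j)) *: u + v) (x i) = 0.
      apply: cW; split; first exact: lW.
      by rewrite /orth /= dotmulDl dotmulZl; field; rewrite lt_eqF.
    under eq_bigr do rewrite dotmulDl dotmulZl mulrDr mulrCA.
    rewrite big_split /= -mulr_sumr => E; rewrite -[RHS]E; congr (_ + _).
    by ring.
Qed.

Lemma gordan (x : I -> 'rV[R]_n) (js : seq I) : uniq js ->
  (exists u, {in js, forall i, 0 < dotmul u (x i)}) \/
  (exists c : I -> R, [/\ forall i, 0 <= c i, exists2 i, i \in js & 0 < c i &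
    \sum_(i <- js) c i *: x i = 0]).
Proof.
move=> ujs; have [||[u _ up]|[c [c0 c1 cW]]] := gordan_subspace x js setT ujs.
- by [].
- by [].
- by left; exists u.
right; exists c; split => //; apply: dotmul_eq0P => w.
by rewrite dotmul_sumr -[RHS](cW w)//; apply: eq_bigr => i _; rewrite dotmulZr.
Qed.

End Gordan.

(** * Product laws on tuples; almost sure general position *)

Section BorelRow.
Context {R : realType} {n : nat}.
Local Notation V := 'rV[R]_n.

Lemma measurable_entry (j : 'I_n) : measurable_fun [set: V] (fun v : V => v 0 j).
Proof.
apply: (measurability _ (measurable_realfun.RGenOpens.measurableE R)).
move=> _ [_ [a [b ->] <-]]; rewrite setTI; apply: sub_sigma_algebra.
have /continuousP cont := @coord_continuous R 1 n 0 j.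
by apply: cont; exact: interval_open.
Qed.

Lemma measurable_dotmul (u : V) : measurable_fun [set: V] (dotmul u).
Proof.
by apply: measurable_sum => i; apply: measurable_funM => //; exact: measurable_entry.
Qed.

Lemma measurable_oppr_row : measurable_fun [set: V] (fun v : V => - v).
Proof.
apply: (@measurability _ _ V V setT (fun v => - v) (@open V)); first by [].
move=> _ [A oA <-]; rewrite setTI; apply: sub_sigma_algebra.
by have /continuousP := @opp_continuous V; exact.
Qed.

End BorelRow.

(** * Laws on tuples determined by boxes, and their invariance under reflection and resampling *)

Section TupleMeasure.
Context {R : realType} {d : measure_display} {V : measurableType d} {N : nat}.
Implicit Types (B : 'I_N -> set V).

Definition box B : set (N.-tuple V) := [set y | forall i, B i (tnth y i)].

Lemma measurable_box B : (forall i, measurable (B i)) -> measurable (box B).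
Proof.
move=> mB; rewrite (_ : box B = \bigcap_(i in [set: 'I_N]) ((@tnth N V)^~ i @^-1` B i)).
  apply: fin_bigcap_measurable => [|i _]; first exact: finite_finset.
  by rewrite -[X in measurable X]setTI; exact: measurable_tnth.
by apply/seteqP; split => y /= h i; [move=> _; exact: h|exact: (h i)].
Qed.

(** Boxes are stable under intersection and generate the product sigma-algebra, so the uniqueness
    theorem for measures applies. *)
Lemma eq_measure_box (m1 m2 : {measure set (N.-tuple V) -> \bar R}) :
  (m1 [set: N.-tuple V] < +oo)%E ->
  (forall B, (forall i, measurable (B i)) -> m1 (box B) = m2 (box B)) ->
  forall A, measurable A -> m1 A = m2 A.
Proof.
move=> m1oo m12; pose G := [set C | exists2 B, (forall i, measurable (B i)) & C = box B].
have GT : G setT.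
  by exists (fun=> setT) => //; apply/seteqP; split.
apply: (measure_unique G (fun=> setT)) => //.
- apply/seteqP; split; last first.
    apply: smallest_sub; first exact: sigma_algebra_measurable.
    by move=> _ [B mB ->]; exact: measurable_box.
  apply: sub_smallest2r; first exact: smallest_sigma_algebra.
  rewrite -bigcup_seq => C [/= i _ [D mD <-]].
  exists (fun j => if j == i then D else setT); first by move=> j; case: ifP.
  apply/seteqP; split=> y /=.
    by move=> [_ yD] j; case: eqP => [->|].
  by move=> /(_ i); rewrite eqxx.
- move=> _ _ [B mB ->] [C mC ->]; exists (fun i => B i `&` C i).
    by move=> i; exact: measurableI.
  apply/seteqP; split=> y /=; first by move=> [yB yC] i; split.
  by move=> h; split=> i; have [] := h i.
- by apply/seteqP; split => // y _; exists 0%N.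
- by move=> _ [B mB ->]; exact: m12.
Qed.

Definition update (j : 'I_N) (p : N.-tuple V * V) : N.-tuple V :=
  [tuple if i == j then p.2 else tnth p.1 i | i < N].

Lemma measurable_update j : measurable_fun setT (update j).
Proof.
apply/measurable_fun_tnthP => i.
rewrite [X in measurable_fun _ X](_ : _ = fun p => if i == j then p.2 else tnth p.1 i); last first.
  by apply/funext => p /=; rewrite tnth_mktuple.
case: (i == j); first exact: measurable_snd.
by apply: (measurableT_comp (measurable_tnth i)); exact: measurable_fst.
Qed.

Definition map_coord (f : V -> V) (j : 'I_N) (y : N.-tuple V) : N.-tuple V :=
  [tuple if i == j then f (tnth y i) else tnth y i | i < N].

Lemma measurable_map_coord f j : measurable_fun setT f ->
  measurable_fun setT (map_coord f j).
Proof.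
move=> mf; apply/measurable_fun_tnthP => i.
rewrite [X in measurable_fun _ X](_ : _ = fun p => if i == j then f (tnth p i) else tnth p i); last first.
  by apply/funext => p /=; rewrite tnth_mktuple.
case: (i == j); last exact: measurable_tnth.
by apply: (measurableT_comp mf); exact: measurable_tnth.
Qed.

Variables (phi : probability V R) (mu : probability (N.-tuple V) R).
Hypothesis mu_box : forall B, (forall i, measurable (B i)) ->
  mu (box B) = (\prod_(i < N) phi (B i))%E.

Lemma iid_map_coord (f : V -> V) j (mf : measurable_fun setT f) :
  (forall B : set V, measurable B -> phi (f @^-1` B) = phi B) ->
  forall A, measurable A -> mu (map_coord f j @^-1` A) = mu A.
Proof.
move=> fphi A mA; have mm := measurable_map_coord _ j mf.
apply/esym; apply: (eq_measure_box mu (measure_function_pushforward__canonical__measure_function_Measure mu mm)) => //.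
  exact: (le_lt_trans (probability_le1 mu measurableT) (ltry 1)).
move=> B mB.
pose B' i := if i == j then f @^-1` B i else B i.
have mB' i : measurable (B' i).
  by rewrite /B'; case: ifP => // _; rewrite -[X in measurable X]setTI; exact: mf.
transitivity (mu (map_coord f j @^-1` box B)); last by [].
rewrite (_ : _ @^-1` _ = box B').
  rewrite [LHS](mu_box _ mB) [RHS](mu_box _ mB').
  apply: eq_bigr => i _; rewrite /B'; case: ifP => // _.
  by rewrite fphi.
apply/seteqP; split=> y /= h i; have := h i; rewrite /B' tnth_mktuple;
  by case: (i == j).
Qed.

(** Resampling one coordinate by an independent vector preserves the law, as seen on boxes; this
    lets null sets be checked section by section. *)
Lemma iid_update j A : measurable A ->
  mu A = (mu \x phi)%E (update j @^-1` A).
Proof.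
move=> mA; have mm := measurable_update j.
apply: (eq_measure_box mu (measure_function_pushforward__canonical__measure_function_Measure (mu \x phi)%E mm)) => //.
  exact: (le_lt_trans (probability_le1 mu measurableT) (ltry 1)).
move=> B mB.
pose B' i := if i == j then setT else B i.
have mB' i : measurable (B' i) by rewrite /B'; case: ifP.
transitivity ((mu \x phi)%E (update j @^-1` box B)); last by [].
rewrite (_ : _ @^-1` _ = box B' `*` B j).
  rewrite product_measure1E//; last exact: measurable_box.
  rewrite [LHS](mu_box _ mB) [X in (X * _)%E](mu_box _ mB').
  rewrite (bigD1 j)//= [in RHS](bigD1 j)//= /B' eqxx.
  rewrite probability_setT mul1e muleC; congr (_ * _)%E.
  by apply: eq_bigr => i /negbTE ->.
apply/seteqP; split=> [[y v] /= h|[y v] /= [h1 h2] i].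
  split; last by have := h j; rewrite tnth_mktuple eqxx.
  by move=> i; have := h i; rewrite /B' tnth_mktuple; case: (i == j).
by rewrite tnth_mktuple /=; have := h1 i; rewrite /B'; case: eqP => [->|].
Qed.

End TupleMeasure.

(** * Almost sure general position *)

Section GeneralPositionAE.
Context {R : realType} {n N : nat}.
Local Notation V := 'rV[R]_n.
Implicit Types (y : N.-tuple V) (s : n.-tuple 'I_N).

Lemma measurable_det d (T : measurableType d) (f : 'I_n -> 'I_n -> T -> R) :
  (forall i j, measurable_fun setT (f i j)) ->
  measurable_fun setT (fun t => \det (\matrix_(i < n, j < n) f i j t)).
Proof.
move=> mf; apply: measurable_sum => p; apply: measurable_funM => //.
apply: measurable_prod => i _.
by under eq_fun do rewrite mxE; exact: mf.
Qed.

(** Interpolates between the identity, at [k = 0], and the matrix of the selected sample points, at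
    [k = n]. *)
Definition partial_mx s (k : nat) y : 'M[R]_n :=
  \matrix_(i < n) if (i < k)%N then tnth y (tnth s i) else delta_mx 0 i.

Lemma measurable_partial_det s k :
  measurable_fun setT (fun y => \det (partial_mx s k y)).
Proof.
rewrite [X in measurable_fun _ X](_ : _ = fun y => \det (\matrix_(i < n, j < n)
  (if (i < k)%N then tnth y (tnth s i) 0 j else (delta_mx 0 i : V) 0 j))); last first.
  apply/funext => y; congr (\det _); apply/matrixP => i j; rewrite !mxE.
  by case: ifP => //; rewrite !mxE.
apply: (measurable_det _ _ (fun i j y =>
  if (i < k)%N then tnth y (tnth s i) 0 j else (delta_mx 0 i : V) 0 j)) => i j.
case: (i < k)%N => //.
apply: (measurableT_comp (measurable_entry j)); exact: measurable_tnth.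
Qed.

(** Pairing with [v] gives the determinant after row [k] is replaced by [v]. Entry [k] is the
    determinant before, so this linear form is nonzero whenever that determinant is. *)
Definition partial_cof s (k : 'I_n) y : V := \row_j cofactor (partial_mx s k y) k j.

Lemma partial_det s (k : 'I_n) y :
  \det (partial_mx s k y) = partial_cof s k y 0 k.
Proof.
rewrite (expand_det_row _ k) (bigD1 k)//= !mxE ltnn mxE !eqxx mul1r.
rewrite big1 ?addr0// => j jk; rewrite mxE ltnn mxE (negbTE jk) andbF mul0r.
by [].
Qed.

Lemma partial_detS s (k : 'I_n) y v : uniq s ->
  \det (partial_mx s k.+1 (update (tnth s k) (y, v))) =
  dotmul (partial_cof s k y) v.
Proof.
move=> us; rewrite (expand_det_row _ k); apply: eq_bigr => j _.
rewrite !mxE ltnS leqnn tnth_mktuple eqxx /= mulrC; congr (_ * _).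
rewrite /cofactor; congr (_ * \det _); apply/matrixP => i l; rewrite !mxE.
set i' := lift k i; have ik : i' != k by rewrite eq_sym neq_lift.
rewrite ltnS leq_eqVlt (_ : (i' == k :> nat) = false) ?(negbTE ik)//=; last first.
  by apply/negbTE.
case: ifP => // _; rewrite tnth_mktuple /=.
rewrite (_ : (tnth s i' == tnth s k) = false)//.
by rewrite (inj_eq (tuple_uniqP _ us)) (negbTE ik).
Qed.

Lemma partial_det_update s (k : 'I_n) y v : uniq s ->
  \det (partial_mx s k (update (tnth s k) (y, v))) = \det (partial_mx s k y).
Proof.
move=> us; congr (\det _); apply/matrixP => i l; rewrite !mxE.
case: ifP => // ik; rewrite tnth_mktuple /=.
rewrite (_ : (tnth s i == tnth s k) = false)//.
by rewrite (inj_eq (tuple_uniqP _ us)); apply/negbTE; rewrite -val_eqE /= ltn_eqF.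
Qed.

Variables (phi : probability V R) (mu : probability (N.-tuple V) R).
Hypothesis mu_box : forall B, (forall i, measurable (B i)) ->
  mu (box B) = (\prod_(i < N) phi (B i))%E.
Hypothesis phi0 : null_on_linear_hyperplanes phi.

(* Rows of the identity are replaced one at a time by sample points; resampling
   the point of index [tnth s k] makes the next determinant a nonzero linear form
   in an independent phi-distributed vector. *)
Lemma partial_det_ae s k : uniq s -> (k <= n)%N ->
  mu [set y | \det (partial_mx s k y) = 0] = 0%E.
Proof.
move=> us; elim: k => [_|k ih kn].
  rewrite (_ : [set _ | _] = set0) ?measure0//; apply/seteqP; split=> // y /=.
  rewrite (_ : partial_mx s 0 y = 1%:M) ?det1; first by move/eqP; rewrite oner_eq0.
  by apply/matrixP => i j; rewrite !mxE/= ?mxE ?eqxx/= eq_sym.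
pose k' := Ordinal kn.
pose D k := [set y | \det (partial_mx s k y) = 0].
have mD l : measurable (D l).
  have := measurable_partial_det s l; move/(_ measurableT [set 0] (measurable_set1 _)).
  by rewrite setTI.
pose E := D k.+1 `\` D k.
have mE : measurable E by exact: measurableD.
have E0 : mu E = 0%E.
  (* The previous determinant does not see the resampled point: the section over [y] is empty if it
     vanishes, and a linear hyperplane otherwise. *)
  rewrite (iid_update _ _ mu_box (tnth s k') _ mE).
  apply: integral0_eq => y _ /=.
  rewrite (_ : xsection _ _ = [set v | \det (partial_mx s k y) <> 0 /\
      dotmul (partial_cof s k' y) v = 0]); last first.
    apply/seteqP; split => v; rewrite /xsection /= inE /E /D /=;
    by rewrite -[k]/(nat_of_ord k') partial_detS// partial_det_update// => -[].
  have [D0|D0] := pselect (\det (partial_mx s k y) = 0).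
    rewrite (_ : [set _ | _] = set0) ?measure0//.
    by apply/seteqP; split => // v [].
  rewrite (_ : [set _ | _] = [set v | dotmul (partial_cof s k' y) v = 0]).
    apply: phi0; apply/eqP => c0; apply: D0.
    by rewrite -[k]/(nat_of_ord k') partial_det c0 mxE.
  by apply/seteqP; split => v // [].
have : D k.+1 `<=` D k `|` E.
  by move=> y Dy; have [|] := pselect (D k y); [left|right].
move=> sub; apply/eqP; rewrite -measure_le0.
apply: le_trans (le_measure mu _ _ sub) _; rewrite ?inE//; first exact: measurableU.
apply: le_trans (measureU2 mu (mD k) mE) _.
by rewrite [X in (_ + X <= _)%E]E0 adde0 [X in (X <= _)%E]ih// ltnW.
Qed.

Definition degenerate : set (N.-tuple V) := [set y | ~ general_position (tnth y)].

Lemma degenerateE : degenerate =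
  \bigcup_(s in [set s : n.-tuple 'I_N | uniq s]) [set y | \det (partial_mx s n y) = 0].
Proof.
have pE s y : \matrix_(i < n) tnth y (tnth s i) = partial_mx s n y.
  by apply/matrixP => i j; rewrite !mxE ltn_ord.
apply/seteqP; split=> y.
  move=> /existsNP[s /not_implyP[us]]; rewrite pE unitmxE unitfE => /negP.
  by rewrite negbK => /eqP D0; exists s.
move=> [s /= us D0] /(_ s us); rewrite pE unitmxE unitfE.
by rewrite D0 eqxx.
Qed.

Lemma measurable_degenerate : measurable degenerate.
Proof.
rewrite degenerateE; apply: fin_bigcup_measurable => [|s us].
  exact: finite_finset.
have := measurable_partial_det s n; move/(_ measurableT [set 0] (measurable_set1 _)).
by rewrite setTI.
Qed.

Lemma degenerate_null : mu degenerate = 0%E.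
Proof.
apply/negligibleP; first exact: measurable_degenerate.
rewrite degenerateE -bigsetU_fset_set; last exact: finite_finset.
rewrite big_seq; elim/big_ind: _ => //; first exact: negligible_set0.
  by move=> A B; exact: negligibleU.
move=> s; rewrite in_fset_set; last exact: finite_finset.
rewrite inE => us; apply/negligibleP; last exact: partial_det_ae.
have := measurable_partial_det s n; move/(_ measurableT [set 0] (measurable_set1 _)).
by rewrite setTI.
Qed.

End GeneralPositionAE.

(** * Wendel's theorem *)

Section Wendel.
Context {R : realType} {n N : nat}.
Local Notation V := 'rV[R]_n.
Implicit Types (y : N.-tuple V) (js K : seq 'I_N).

Definition one_sided js : set (N.-tuple V) :=
  [set y | exists u, {in js, forall i, 0 < dotmul u (tnth y i)}].

(** Finitely many strict inequalities survive a small perturbation of [u], so a witness can be taken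
    rational. *)
Lemma positive_near js y (u : V) : {in js, forall i, 0 < dotmul u (tnth y i)} ->
  exists2 e : R, 0 < e & forall w : V, (forall l, `|w 0 l - u 0 l| < e) ->
    {in js, forall i, 0 < dotmul w (tnth y i)}.
Proof.
elim: js => [|j js ih] up; first by exists 1.
have [|e e0 he] := ih; first by move=> i ij; apply: up; rewrite inE ij orbT.
have uj := up _ (mem_head _ _).
pose b := \sum_l `|tnth y j 0 l| + 1.
have b0 : 0 < b by apply: ltr_wpDl => //; exact: sumr_ge0.
exists (Num.min e (dotmul u (tnth y j) / b)).
  by rewrite lt_min e0 divr_gt0.
move=> w hw i; rewrite inE => /predU1P[->|ij]; last first.
  by apply: he => // l; have := hw l; rewrite lt_min => /andP[].
have -> : w = u + (w - u) by rewrite addrC subrK.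
rewrite dotmulDl -ltrBlDr sub0r; apply: le_lt_trans (ler_norm _) _.
rewrite normrN; apply: le_lt_trans (ler_norm_sum _ _ _) _.
apply: (@le_lt_trans _ _ (dotmul u (tnth y j) / b * \sum_l `|tnth y j 0 l|)).
  rewrite mulr_sumr; apply: ler_sum => l _; rewrite normrM ler_wpM2r//.
  by have := hw l; rewrite lt_min !mxE => /andP[_ /ltW].
by rewrite mulrAC -mulrA gtr_pMr// ltr_pdivrMr// mul1r /b ltrDl.
Qed.

(** The uncountable union over witnesses [u] equals the countable one over rational vectors. *)
Lemma measurable_one_sided js : measurable (one_sided js).
Proof.
rewrite (_ : one_sided js = \bigcup_(q in [set: n.-tuple rat])
    \bigcap_(i in [set` js]) [set y | 0 < dotmul (\row_l ratr (tnth q l)) (tnth y i)]).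
  apply: countable_bigcupT_measurable => [|q]; first exact: countableP.
  apply: fin_bigcap_measurable => [|i _]; first exact: finite_seq.
  have mf : measurable_fun setT (fun y : N.-tuple V => dotmul (\row_l ratr (tnth q l)) (tnth y i)).
    by apply: (measurableT_comp (measurable_dotmul _)); exact: measurable_tnth.
  have := mf measurableT _ (measurable_itv `]0, +oo[); rewrite setTI.
  by congr measurable; apply/seteqP; split=> y /=; rewrite in_itv/= andbT.
apply/seteqP; split=> y /=; last first.
  by move=> [q _ h]; exists (\row_l ratr (tnth q l)) => i ij; exact: h.
move=> [u up]; have [e e0 he] := positive_near _ _ _ up.
have hq (l : 'I_n) : {q : rat | ratr q \in `](u 0 l), (u 0 l + e)[}.
  by apply: cid; apply: rat_in_itvoo; rewrite ltrDl.
exists [tuple sval (hq l) | l < n] => // i ij; apply: he => // l.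
rewrite mxE tnth_mktuple; case: (hq l) => q /=; rewrite in_itv /= => /andP[h1 h2].
by rewrite ltr_norml; lra.
Qed.

(** Signs on [K] are prescribed positive, those on [js] are free. It interpolates between the
    indicator of [one_sided K], for empty [js], and the full pattern count, for empty [K]. *)
Definition pattern_count K js y : nat :=
  npatterns [set u : V | {in K, forall i, 0 < dotmul u (tnth y i)}] (map (tnth y) js).

Local Notation flip := (map_coord (fun v : V => - v)).

(** A negative sign at [j] becomes positive once the point of index [j] is reflected, and no other
    point moves. *)
Lemma pattern_count_cons K j js y : j \notin K -> j \notin js ->
  pattern_count K (j :: js) y =
  (pattern_count (j :: K) js y + pattern_count (j :: K) js (flip j y))%N.
Proof.
move=> jK jjs; rewrite /pattern_count /=.
have fi i : i != j -> tnth (flip j y) i = tnth y i.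
  by move=> ij; rewrite tnth_mktuple (negbTE ij).
have fj : tnth (flip j y) j = - tnth y j by rewrite tnth_mktuple eqxx.
have nj (s : seq 'I_N) i : j \notin s -> i \in s -> i != j.
  by move=> js' si; apply: contraNneq js' => <-.
rewrite (_ : map (tnth (flip j y)) js = map (tnth y) js); last first.
  by apply/eq_in_map => i ij; rewrite fi// (nj js).
congr (_ + _)%N; congr (npatterns _ _); apply/seteqP; split=> u.
- by move=> [uK uj] i; rewrite inE => /predU1P[->|/uK].
- move=> h; split; first by move=> i iK; apply: h; rewrite inE iK orbT.
  by apply: h; rewrite mem_head.
- move=> [uK uj] i; rewrite inE => /predU1P[->|iK]; first by rewrite fj.
  by rewrite fi ?(nj K)//; exact: uK.
- move=> h; split.
    by move=> i iK; rewrite -fi ?(nj K)//; apply: h; rewrite inE iK orbT.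
  by rewrite /pos_half /= -fj; apply: h; rewrite mem_head.
Qed.

Lemma pattern_count_nil K y : ((pattern_count K [::] y)%:R : R) = \1_(one_sided K) y.
Proof.
by rewrite /pattern_count /= indicE; congr (nat_of_bool _)%:R.
Qed.

Lemma measurable_pattern_count K js : uniq (js ++ K) ->
  measurable_fun setT (fun y => ((pattern_count K js y)%:R)%:E : \bar R).
Proof.
elim: js K => [|j js ih] K u.
  under eq_fun do rewrite pattern_count_nil.
  by apply/measurable_EFinP; apply: measurable_indic; exact: measurable_one_sided.
have [jK jjs] : j \notin K /\ j \notin js.
  by move: u => /= /andP[]; rewrite mem_cat negb_or => /andP[].
have u' : uniq (js ++ j :: K).
  rewrite (perm_uniq (_ : perm_eq _ ((j :: js) ++ K)))//.
  by rewrite -cat_rcons -cat1s perm_cat2r perm_rcons.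
under eq_fun do rewrite pattern_count_cons// natrD EFinD.
apply: emeasurable_funD; first exact: ih.
by apply: (measurableT_comp (ih _ u')); apply: measurable_map_coord; exact: measurable_oppr_row.
Qed.

Variables (phi : probability V R) (mu : probability (N.-tuple V) R).
Hypothesis mu_box : forall B, (forall i, measurable (B i)) ->
  mu (box B) = (\prod_(i < N) phi (B i))%E.
Hypothesis phi_even : even_measure phi.
Hypothesis phi0 : null_on_linear_hyperplanes phi.

Lemma integral_flip j (f : N.-tuple V -> \bar R) : measurable_fun setT f ->
  (forall y, 0 <= f y)%E -> (\int[mu]_y f (flip j y) = \int[mu]_y f y)%E.
Proof.
move=> mf f0; have mm := measurable_map_coord _ j (@measurable_oppr_row R n).
rewrite -[LHS](@ge0_integral_pushforward _ _ _ _ _ _ mm mu setT f)//.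
apply: (eq_measure_integral mu (m1 := measure_function_pushforward__canonical__measure_function_Measure mu mm)) => A mA _.
exact: (iid_map_coord phi mu mu_box _ j measurable_oppr_row phi_even).
Qed.

(** Reflections preserve [mu], so the two summands of [pattern_count_cons] have equal integrals and
    each free sign contributes a factor 2. *)
Lemma integral_pattern_count K js : uniq (js ++ K) ->
  (\int[mu]_y ((pattern_count K js y)%:R)%:E =
   ((2 ^ size js)%:R)%:E * mu (one_sided (js ++ K)))%E.
Proof.
elim: js K => [|j js ih] K u.
  under eq_integral do rewrite pattern_count_nil.
  by rewrite integral_indic//= ?setIT ?mul1e//; exact: measurable_one_sided.
have [jK jjs] : j \notin K /\ j \notin js.
  by move: u => /= /andP[]; rewrite mem_cat negb_or => /andP[].
have pu : perm_eq (js ++ j :: K) ((j :: js) ++ K).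
  by rewrite -cat_rcons -cat1s perm_cat2r perm_rcons.
have u' : uniq (js ++ j :: K) by rewrite (perm_uniq pu).
have mp := measurable_pattern_count _ _ u'.
under eq_integral do rewrite pattern_count_cons// natrD EFinD.
rewrite ge0_integralD//=; last first.
  by apply: (measurableT_comp mp); apply: measurable_map_coord; exact: measurable_oppr_row.
rewrite (integral_flip j _ mp)// ih// expnS natrM EFinM -muleA.
rewrite (_ : one_sided (js ++ j :: K) = one_sided (j :: js ++ K)).
  by rewrite [RHS]mule_natl mule2n.
have pm := perm_mem pu.
by apply/seteqP; split => y [w wp]; exists w => i ij; apply: wp; rewrite -?pm// pm.
Qed.

(** With no sign prescribed, the pattern count equals the [schlafli] number off the null set of
    degenerate tuples; its integral is also [2 ^ size js] times the probability sought. *)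
Lemma wendel js : (n <= N)%N -> uniq js ->
  mu (one_sided js) = ((schlafli n (size js))%:R / (2 ^ size js)%:R)%:E.
Proof.
move=> nN u; have u0 : uniq (js ++ [::]) by rewrite cats0.
have := integral_pattern_count [::] js u0; rewrite cats0.
rewrite (_ : (\int[mu]_y _ = ((schlafli n (size js))%:R)%:E)%E); last first.
  rewrite -[RHS]mule1 -(probability_setT mu) -integral_cst//.
  apply: ge0_ae_eq_integral => //; first exact: measurable_pattern_count.
    by move=> y _; rewrite lee_fin.
  exists (@degenerate R n N); split.
  - exact: measurable_degenerate.
  - exact: degenerate_null mu_box phi0.
  move=> y /= h gy; apply: h => _.
  rewrite /pattern_count (_ : [set _ | _] = orths (tnth y) [::]); last first.
    by apply/seteqP; split.
  by rewrite (npatterns_general_position nN _ gy [::])//= subn0.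
have fm : mu (one_sided js) \is a fin_num.
  exact: (fin_num_measure mu _ (measurable_one_sided js)).
rewrite -(fineK fm) -EFinM => -[->].
by rewrite mulrC mulKf// pnatr_eq0 expn_eq0.
Qed.

End Wendel.

(** * Faces and Gale duality *)

Section Combos.
Context {R : realType} {m N : nat}.
Implicit Types (a : 'I_N -> 'rV[R]_m) (I : {set 'I_N}).

Definition combos a I : set 'rV[R]_m :=
  [set z | exists c : 'I_N -> R, [/\ forall i, 0 <= c i, \sum_i c i = 1,
    forall i, i \notin I -> c i = 0 & z = \sum_i c i *: a i]].

Lemma combos_mem a I i : i \in I -> combos a I (a i).
Proof.
move=> iI; exists (fun j => (j == i)%:R); split.
- by move=> j; rewrite ler0n.
- by rewrite (bigD1 i)//= eqxx big1 ?addr0// => j /negbTE ->.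
- by move=> j jI; case: eqP => // ji; rewrite ji iI in jI.
- rewrite (bigD1 i)//= eqxx scale1r big1 ?addr0// => j /negbTE ->.
  by rewrite scale0r.
Qed.

Lemma sub_combos a I : combos a I `<=` combos a [set: 'I_N]%SET.
Proof. by move=> z [c [c0 c1 cI zE]]; exists c; split => // i; rewrite inE. Qed.

Lemma conv_rowE (t : {i01 R}) (u v : convex_lmodType 'rV[R]_m) :
  conv t u v = (t%:num *: (u : 'rV[R]_m) + (1 - t%:num) *: (v : 'rV[R]_m)).
Proof. by []. Qed.

(** The sum is normalised so that the induction applies to tails whose weights do not add up to
    1. *)
Lemma convex_set_combination (A : set 'rV[R]_m) a (s : seq 'I_N) (c : 'I_N -> R) :
  convex_set A -> (forall i, A (a i)) -> (forall i, 0 <= c i) ->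
  0 < \sum_(i <- s) c i ->
  A ((\sum_(i <- s) c i)^-1 *: \sum_(i <- s) c i *: a i).
Proof.
move=> cA Aa c0; elim: s => [|i s ih]; first by rewrite big_nil ltxx.
rewrite !big_cons; set S := \sum_(j <- s) c j => S0.
have Sge0 : 0 <= S by exact: sumr_ge0.
have [SE|Sn0] := eqVneq S 0.
  rewrite SE addr0 in S0 *; rewrite [X in _ + X]big_seq big1 ?addr0.
    by rewrite scalerA mulVf ?scale1r// gt_eqF.
  move=> j js; suff -> : c j = 0 by rewrite scale0r.
  apply/eqP; rewrite eq_le c0 andbT -SE /S (big_rem j)//= lerDl.
  exact: sumr_ge0.
have Sgt0 : 0 < S by rewrite lt_neqAle eq_sym Sn0.
have t0 : 0 <= c i / (c i + S) by rewrite divr_ge0 ?(ltW S0).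
have t1 : c i / (c i + S) <= 1 by rewrite ler_pdivrMr// mul1r lerDl.
have := cA (a i) _ (Itv01 t0 t1) (mem_set (Aa i)) (mem_set (ih Sgt0)).
move=> /set_mem; congr A; rewrite conv_rowE /= scalerA scalerDr scalerA.
congr (_ *: _ + _ *: _); first by rewrite mulrC.
by rewrite -/S; field; rewrite Sn0 gt_eqF.
Qed.

Lemma conv_hull_combos a : conv_hull (range a) = combos a [set: 'I_N]%SET.
Proof.
apply/seteqP; split.
  apply: smallest_sub; last by move=> _ [i _ <-]; apply: combos_mem; rewrite inE.
  move=> z w t /set_mem[c [c0 c1 _ ->]] /set_mem[e [e0 e1 _ ->]]; apply/mem_set.
  exists (fun i => t%:num * c i + (1 - t%:num) * e i); split.
  - move=> i; rewrite addr_ge0// mulr_ge0// ?ge0// subr_ge0; exact: le1.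
  - by rewrite big_split /= -!mulr_sumr c1 e1 !mulr1 addrC subrK.
  - by move=> i; rewrite inE.
  - rewrite conv_rowE !scaler_sumr -big_split /=; apply: eq_bigr => i _.
    by rewrite [RHS]scalerDl !scalerA.
move=> z [c [c0 c1 _ ->]] A [cA Aa].
have := convex_set_combination A a (index_enum _) c cA; rewrite c1 invr1 scale1r.
by apply => // i; apply: Aa; exists i.
Qed.

Lemma dotmul_combos a I (c : 'I_N -> R) u : \sum_i c i = 1 ->
  forall b, b - dotmul u (\sum_i c i *: a i) = \sum_i c i * (b - dotmul u (a i)).
Proof.
move=> c1 b; rewrite dotmul_sumr -[X in X - _]mul1r -c1 mulr_suml -sumrB.
by apply: eq_bigr => i _; rewrite dotmulZr mulrBr.
Qed.

Lemma psumr_eq0_all (c : 'I_N -> R) : (forall i, 0 <= c i) -> \sum_i c i = 0 ->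
  forall i, c i = 0.
Proof.
move=> c0 /eqP; rewrite psumr_eq0// => /allP h i; apply/eqP.
by have := h i (mem_index_enum _); rewrite implyTb.
Qed.

(** The slack [b - dotmul u _] of a convex combination is the weighted mean of the slacks of the
    points, so it vanishes only if all weight sits on points of zero slack. *)
Lemma supporting_combos a I u b : (forall i, 0 <= b - dotmul u (a i)) ->
  (forall i, (i \in I) = (b - dotmul u (a i) == 0)) ->
  (forall x, combos a [set: 'I_N]%SET x -> dotmul u x <= b) /\
  combos a I = combos a [set: 'I_N]%SET `&` [set x | dotmul u x = b].
Proof.
move=> h0 hI; split.
  move=> _ [c [c0 c1 _ ->]]; rewrite -subr_ge0 dotmul_combos//.
  by apply: sumr_ge0 => i _; exact: mulr_ge0.
apply/seteqP; split => [z zI|z [[c [c0 c1 _ zE]] /= uz]].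
  split; first exact: sub_combos zI.
  case: zI => c [c0 c1 cI ->] /=; apply/eqP; rewrite eq_sym -subr_eq0 dotmul_combos//.
  apply/eqP; rewrite big1// => i _; have [|iI] := boolP (i \in I).
    by rewrite hI => /eqP ->; rewrite mulr0.
  by rewrite cI ?mul0r.
exists c; split => // i; rewrite hI => hi.
have /psumr_eq0_all : \sum_i c i * (b - dotmul u (a i)) = 0.
  by rewrite -dotmul_combos// -zE uz subrr.
move=> /(_ _ i); rewrite mulrC => /(_ _)/eqP; rewrite mulf_eq0 (negbTE hi) /=.
by move=> E; apply/eqP/E => j; exact: mulr_ge0.
Qed.

(** Makes the dimension in [has_affine_dim] independent of the chosen base point and direction
    space. *)
Lemma translate_vspace_inj (x y : 'rV[R]_m) (U W : {vspace 'rV[R]_m}) :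
  [set x + u | u in [set` U]] = [set y + u | u in [set` W]] -> U = W.
Proof.
move=> E.
have [w Ww xE] : [set y + u | u in [set` W]] x.
  by rewrite -E; exists 0; rewrite ?addr0//=; exact: mem0v.
apply/vspaceP => u; apply/idP/idP => h.
  have : [set x + u | u in [set` U]] (x + u) by exists u.
  rewrite E => -[w' Ww']; rewrite -xE -addrA => /addrI E'.
  by rewrite -[u](addKr w) -E' addrC rpredB.
have : [set y + u | u in [set` W]] (y + (w + u)).
  by exists (w + u) => //=; rewrite rpredD.
by rewrite addrA xE -E => -[w' Uw' /addrI <-].
Qed.

Lemma affine_hull_mono (A B : set 'rV[R]_m) : A `<=` B -> affine_hull A `<=` affine_hull B.
Proof.
move=> AB z [l [p [c [pA c1 zE]]]]; exists l, p, c; split => // i.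
exact/AB.
Qed.

Lemma affine_hull_dim_full (A : set 'rV[R]_m) k : affine_hull A = setT ->
  has_affine_dim A k -> k = m.
Proof.
move=> AT [x [U [<- AE]]].
suff -> : U = fullv by rewrite dimvf /dim /= mul1n.
apply: (@translate_vspace_inj x 0); rewrite -AE AT; apply/seteqP; split => // z _.
by exists z; rewrite ?add0r//= memvf.
Qed.

Definition affinely_independent a I : Prop :=
  forall c : 'I_N -> R, (forall i, i \notin I -> c i = 0) ->
    \sum_i c i *: a i = 0 -> \sum_i c i = 0 -> forall i, c i = 0.

(** For a fixed [i0] in [I], the differences of the other points of [I] with [a i0] form a basis of
    the direction of the affine hull. *)
Lemma combos_affine_dim a I k : affinely_independent a I ->
  has_affine_dim (combos a I) k <-> #|I| = k.+1.
Proof.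
(* For empty [I] there are no combinations, and the empty set has no affine dimension. *)
move=> aI; have [I0|[i0 i0I]] := set_0Vmem I.
  split; last by rewrite I0 cards0.
  move=> [x [U [_ AE]]]; have : affine_hull (combos a I) x.
    by rewrite AE; exists 0; rewrite ?addr0//=; exact: mem0v.
  move=> [l [p [c [pA c1 _]]]].
  have l0 : 'I_l -> False.
    move=> j; have [e [_ e1 eI _]] := pA j; move/eqP: e1.
    by rewrite big1 ?(eq_sym 0) ?oner_eq0// => i _; rewrite eI// I0 inE.
  by move/eqP: c1; rewrite big1 ?(eq_sym 0) ?oner_eq0// => j; case: (l0 j).
pose A := I :\ i0.
pose X : #|A|.-tuple 'rV[R]_m := [tuple a (enum_val j) - a i0 | j < #|A|].
have XE (j : 'I_#|A|) : X`_j = a (enum_val j) - a i0 by rewrite -tnth_nth tnth_mktuple.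
have spread (e : 'I_#|A| -> R) (F : 'I_N -> 'rV[R]_m) :
    \sum_i (\sum_(j | enum_val j == i) e j) *: F i = \sum_j e j *: F (enum_val j).
  under eq_bigr do rewrite scaler_suml.
  rewrite (exchange_big_dep predT) //=; apply: eq_bigr => j _.
  by rewrite (eq_bigl (pred1 (enum_val j))) ?big_pred1_eq// => i; rewrite eq_sym.
have spread1 (e : 'I_#|A| -> R) :
    \sum_i (\sum_(j | enum_val j == i) e j) = \sum_j e j.
  rewrite (exchange_big_dep predT) //=; apply: eq_bigr => j _.
  by rewrite (eq_bigl (pred1 (enum_val j))) ?big_pred1_eq// => i; rewrite eq_sym.
have spread0 (e : 'I_#|A| -> R) i : i \notin A -> \sum_(j | enum_val j == i) e j = 0.
  move=> iA; rewrite big1// => j /eqP ji; case/negP: iA; rewrite -ji; exact: enum_valP.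
(* Coefficients on the differences become coefficients on the points with total 0, the balance being
   put on [i0]. *)
pose aff (e : 'I_#|A| -> R) i :=
  (\sum_(j | enum_val j == i) e j) - (i == i0)%:R * \sum_j e j.
have sum_i0 (b : R) : \sum_i (i == i0)%:R * b = b.
  by rewrite (bigD1 i0)//= eqxx mul1r big1 ?addr0// => i /negbTE ->; rewrite mul0r.
have aff1 e : \sum_i aff e i = 0.
  by rewrite sumrB spread1 sum_i0 subrr.
have affa e : \sum_i aff e i *: a i = \sum_j e j *: X`_j.
  under eq_bigr do rewrite scalerBl.
  rewrite sumrB spread [X in _ - X](_ : _ = (\sum_j e j) *: a i0); last first.
    rewrite (bigD1 i0)//= eqxx mul1r [X in _ + X]big1 ?addr0// => i /negbTE ->.
    by rewrite mul0r scale0r.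
  rewrite scaler_suml -sumrB; apply: eq_bigr => j _.
  by rewrite XE scalerBr.
have aff0 e i : i \notin I -> aff e i = 0.
  move=> iI; rewrite /aff spread0 ?inE ?(negbTE iI) ?andbF// (_ : i == i0 = false) ?mul0r ?subr0//.
  by apply: contraNF iI => /eqP ->.
have fX : free X.
  apply/freeP => e e0 j; have /aI h : forall i, i \notin I -> aff e i = 0 by exact: aff0.
  have := h _ (aff1 e) (enum_val j); rewrite affa e0 => /(_ erefl).
  rewrite /aff (_ : enum_val j == i0 = false); last first.
    by have := enum_valP j; rewrite !inE => /andP[/negbTE].
  rewrite mul0r subr0 (eq_bigl (pred1 j)) ?big_pred1_eq// => j'.
  by rewrite (inj_eq enum_val_inj).
have dX : \dim <<X>> = #|A| by rewrite (eqP fX) size_tuple.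
have cA : #|I| = #|A|.+1 by rewrite /A (cardsD1 i0) i0I.
have hullE : affine_hull (combos a I) = [set a i0 + u | u in [set` <<X>>%VS]].
  have diff (e : 'I_N -> R) : (forall i, i \notin I -> e i = 0) -> \sum_i e i = 1 ->
      \sum_i e i *: a i - a i0 \in <<X>>%VS.
    move=> e0 e1; rewrite -[a i0]scale1r -e1 scaler_suml -sumrB.
    apply: rpred_sum => i _; rewrite -scalerBr.
    have [iI|iI] := boolP (i \in I); last by rewrite e0// scale0r mem0v.
    have [->|ii0] := eqVneq i i0; first by rewrite subrr scaler0 mem0v.
    have iA : i \in A by rewrite !inE ii0.
    apply/rpredZ/memv_span; apply/tnthP; exists (enum_rank_in iA i).
    by rewrite tnth_mktuple enum_rankK_in.
  apply/seteqP; split => z.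
    move=> [l [p [c [pA c1 ->]]]].
    exists (\sum_j c j *: p j - a i0); last by rewrite addrC subrK.
    rewrite /= (_ : _ - _ = \sum_j c j *: (p j - a i0)); last first.
      under [RHS]eq_bigr do rewrite scalerBr.
      by rewrite sumrB -scaler_suml c1 scale1r.
    apply: rpred_sum => j _; apply: rpredZ.
    by have [e [_ e1 e0 ->]] := pA j; exact: diff.
  move=> [u /= uX <-]; pose e j := coord X j u.
  (* Indices outside [I] carry weight 0, so any point of the set, here [a i0], can stand in for
     them. *)
  exists N, (fun i => if i \in I then a i else a i0), (fun i => aff e i + (i == i0)%:R).
  split.
  - by move=> i; case: ifP => // iI; exact: combos_mem.
  - rewrite big_split /= aff1 add0r -[RHS](sum_i0 1).
    by apply: eq_bigr => i _; rewrite mulr1.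
  - rewrite (eq_bigr (fun i => aff e i *: a i + (i == i0)%:R *: a i)).
      rewrite big_split /= affa -coord_span// addrC; congr (_ + _).
      by rewrite (bigD1 i0)//= eqxx scale1r big1 ?addr0// => i /negbTE ->; rewrite scale0r.
    move=> i _; case: ifPn => iI; first by rewrite scalerDl.
    rewrite aff0// (_ : i == i0 = false) ?scale0r ?addr0 ?scale0r ?addr0//.
    by apply: contraNF iI => /eqP ->.
split=> [[x [U [dU AE]]]|cI].
  rewrite cA -dX -dU; congr (\dim _).+1.
  by apply: (@translate_vspace_inj (a i0) x); rewrite -hullE.
by exists (a i0), <<X>>%VS; split => //; move: cI; rewrite cA dX => -[].
Qed.

End Combos.

(** * Faces of the polytope as cofaces of the Gale diagram *)

Section GaleDuality.
Context {R : realType} {d n N : nat}.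
Hypothesis Nnd : N = (n + d).+1.
Variables (x : 'I_N -> 'rV[R]_n) (l : 'I_N -> R) (a : 'I_N -> 'rV[R]_d).
Hypothesis gx : general_position x.
Hypothesis l0 : forall i, 0 < l i.
Hypothesis gale : is_gale_transform a (fun i => l i *: x i).

Let nN : (n <= N)%N. Proof. by rewrite Nnd -addnS leq_addr. Qed.

(* The origin lies in the relative interior of the convex hull of the x_i, i
   outside I. *)
Definition coface (I : {set 'I_N}) : Prop := exists c : 'I_N -> R,
  [/\ forall i, i \in I -> c i = 0, forall i, i \notin I -> 0 < c i &
      \sum_i c i *: x i = 0].

(** Values of affine functions on the points form the row space of the matrix [B] of homogeneous
    coordinates, which is the orthogonal complement of the affine dependences, that is, of the rows
    of the Gale matrix. *)
Lemma gale_affine_functional (h : 'I_N -> R) :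
  \sum_i h i *: (l i *: x i) = 0 ->
  exists u b, forall i, h i = b - dotmul u (a i).
Proof.
move=> hx; case: gale => _ _ dep; set M := \matrix_(_ < n, _ < N) _ in dep.
pose H : 'rV[R]_N := \row_i h i.
pose B : 'M[R]_(d + 1, N) := col_mx (\matrix_(r, i) a i 0 r) (const_mx 1).
have cB : B *m cokermx B = 0 by exact: mulmx_coker.
have : (H <= B)%MS.
  (* Each column of the cokernel of [B] is an affine dependence, hence a combination of rows of [M],
     all orthogonal to [H]. *)
  rewrite submxE; apply/eqP/rowP => j.
  pose lam : 'rV[R]_N := (col j (cokermx B))^T.
  have : (lam <= M)%MS.
    apply/dep; move: cB; rewrite mul_col_mx => /eqP; rewrite col_mx_eq0.
    move=> /andP[/eqP e1 /eqP e2]; split.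
      apply/rowP => r; move/matrixP/(_ r j): e1.
      rewrite !mxE summxE => E; rewrite -[RHS]E; apply: eq_bigr => i _.
      by rewrite !mxE mulrC.
    move/matrixP/(_ 0 j): e2.
    rewrite !mxE => E; rewrite -[RHS]E; apply: eq_bigr => i _.
    by rewrite !mxE mul1r.
  move=> /submxP[D DE].
  have MH : M *m H^T = 0.
    apply/colP => r; move/rowP/(_ r): hx; rewrite summxE !mxE => E.
    by rewrite -[RHS]E; apply: eq_bigr => i _; rewrite !mxE mulrC.
  have : lam *m H^T = 0 by rewrite DE -mulmxA MH mulmx0.
  move/matrixP/(_ 0 0); rewrite !mxE => E; rewrite -[RHS]E.
  by apply: eq_bigr => i _; rewrite !mxE mulrC.
move=> /submxP[D DE].
exists (- lsubmx D), (rsubmx D 0 0) => i.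
have -> : h i = H 0 i by rewrite mxE.
rewrite DE -[D in LHS]hsubmxK mul_row_col mxE addrC; congr (_ + _).
  by rewrite mxE big_ord1 [X in _ * X]mxE mulr1.
rewrite dotmulNl opprK mxE.
by apply: eq_bigr => r _; rewrite !mxE.
Qed.

Lemma affine_functional_gale (h : 'I_N -> R) u b :
  (forall i, h i = b - dotmul u (a i)) -> \sum_i h i *: (l i *: x i) = 0.
Proof.
move=> hE; case: gale => _ _ dep; set M := \matrix_(_ < n, _ < N) _ in dep.
apply/rowP => r; have [|e1 e2] := (dep (row r M)).1; first exact: row_sub.
rewrite summxE mxE.
transitivity (\sum_i row r M 0 i * h i).
  by apply: eq_bigr => i _; rewrite !mxE mulrC.
under eq_bigr do rewrite hE mulrBr.
rewrite sumrB -mulr_suml e2 mul0r sub0r.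
transitivity (- dotmul u (\sum_i row r M 0 i *: a i)).
  by rewrite dotmul_sumr; congr (- _); apply: eq_bigr => i _; rewrite dotmulZr.
by rewrite e1 dotmul0r oppr0.
Qed.

Lemma gale_dependence (c : 'I_N -> R) :
  \sum_i c i *: a i = 0 -> \sum_i c i = 0 ->
  exists w, forall i, c i = l i * dotmul w (x i).
Proof.
move=> ca c1; case: gale => _ _ dep; set M := \matrix_(_ < n, _ < N) _ in dep.
have : (\row_i c i <= M)%MS.
  apply/dep; split.
    by rewrite -[RHS]ca; apply: eq_bigr => i _; rewrite mxE.
  by rewrite -[RHS]c1; apply: eq_bigr => i _; rewrite mxE.
move=> /submxP[D DE]; exists D => i.
have -> : c i = (\row_i c i) 0 i by rewrite mxE.
rewrite DE mxE /dotmul mulr_sumr; apply: eq_bigr => r _.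
by rewrite !mxE mulrCA.
Qed.

(** A dependence has the form [l i * dotmul w (x i)]; if it is supported on [I], then [w] is
    orthogonal to at least [n] vectors in general position. *)
Lemma cofacet_affinely_independent (I : {set 'I_N}) : (n <= #|~: I|)%N ->
  affinely_independent a I.
Proof.
move=> nI c cI ca c1; have [w wE] := gale_dependence c ca c1.
suff w0 : w = 0 by move=> i; rewrite wE w0 dotmul0l mulr0.
apply: (general_position_orth x gx (enum (~: I)) w) => //.
- exact: enum_uniq.
- by rewrite -cardE.
- move=> i; rewrite mem_enum inE => iI; have /eqP := cI _ iI.
  by rewrite wE mulf_eq0 gt_eqF//= => /eqP.
Qed.

(** On at most [n] vectors in general position some [v] takes the value 1 throughout; pairing it
    with the dependence makes the sum of the nonnegative coefficients zero. *)
Lemma nonneg_dependence_support (c : 'I_N -> R) : (forall i, 0 <= c i) ->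
  (exists i, c i != 0) -> \sum_i c i *: x i = 0 -> (n < #|[set i | (c i != 0)%R]%SET|)%N.
Proof.
move=> c0 [i0 ci0] cx; rewrite ltnNge; apply/negP => sn.
have [||v vE] := general_position_interp nN x gx (enum [set i | c i != 0]%SET) (fun=> 1).
- exact: enum_uniq.
- by rewrite -cardE.
have : dotmul v (\sum_i c i *: x i) = \sum_i c i.
  rewrite dotmul_sumr; apply: eq_bigr => i _; rewrite dotmulZr.
  have [->|ci] := eqVneq (c i) 0; first by rewrite mul0r.
  by rewrite vE ?mulr1// mem_enum inE.
rewrite cx dotmul0r => /esym /(psumr_eq0_all _ c0) /(_ i0) /eqP.
by rewrite (negbTE ci0).
Qed.

(** Gordan's alternative gives only a nonnegative dependence off [I]; general position makes its
    support large enough to span, which permits a perturbation that is positive at every index off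
    [I]. *)
Lemma coface_one_sided (I : {set 'I_N}) : (#|I| < N)%N ->
  coface I <-> ~ exists u, {in ~: I, forall i, 0 < dotmul u (x i)}.
Proof.
move=> IN; split.
  move=> [c [cI cpos cx]] [u up].
  have : dotmul u (\sum_i c i *: x i) = 0 by rewrite cx dotmul0r.
  rewrite dotmul_sumr => /psumr_eq0_all h.
  have [i iI] : exists i, i \in ~: I.
    apply/set0Pn; rewrite -card_gt0; have := cardsC I; rewrite card_ord => E.
    by rewrite -(ltn_add2l #|I|) addn0 E.
  have := h _ i; rewrite dotmulZr => /(_ _)/eqP; rewrite mulf_eq0 => E.
  have iI' : i \notin I by rewrite inE in iI.
  have : (c i == 0) || (dotmul u (x i) == 0).
    apply: E => j; rewrite dotmulZr; have [jI|jI] := boolP (j \in I).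
      by rewrite cI// mul0r.
    by rewrite mulr_ge0 ?ltW ?cpos ?up// inE.
  by rewrite !gt_eqF ?cpos ?up.
move=> nside; have [[u up]|[c [c0 [i0 i0I ci0] cx]]] := gordan x (enum (~: I)) (enum_uniq _).
  by exfalso; apply: nside; exists u => i iI; apply: up; rewrite mem_enum.
pose e i := if i \in ~: I then c i else 0.
have e0 i : 0 <= e i by rewrite /e; case: ifP.
have ex : \sum_i e i *: x i = 0.
  rewrite -[RHS]cx big_enum [RHS]big_mkcond /=; apply: eq_bigr => i _.
  by rewrite /e; case: ifP => // _; rewrite scale0r.
pose T := [set i | e i != 0]%SET.
have nT : (n < #|T|)%N.
  apply: nonneg_dependence_support => //; exists i0.
  by rewrite /e; rewrite mem_enum in i0I; rewrite i0I gt_eqF.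
have [||f [fT fE]] := general_position_span x gx (enum T) (- \sum_(i in ~: I) x i).
- exact: enum_uniq.
- by rewrite -cardE ltnW.
pose K := \sum_i `|f i| / e i.
have Kf i : `|f i| <= K * e i.
  have [ei|ei] := eqVneq (e i) 0.
    by rewrite fT ?normr0 ?ei ?mulr0// mem_enum inE ei eqxx.
  rewrite -ler_pdivrMr; last by rewrite lt_neqAle eq_sym ei e0.
  rewrite /K (bigD1 i)//= lerDl; apply: sumr_ge0 => j _.
  by rewrite divr_ge0.
(* [f] cancels the sum of the [x i] off [I], and [K] makes [K * e i + f i] nonnegative, so the added
   1 gives strict positivity. *)
exists (fun i => K * e i + f i + (i \in ~: I)%:R); split.
- move=> i iI; have iI' : (i \in ~: I) = false by rewrite inE iI.
  have ei : e i = 0 by rewrite /e iI'.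
  by rewrite ei iI' fT ?mulr0 ?addr0// mem_enum inE ei eqxx.
- move=> i iI; rewrite inE iI /=; have := Kf i; have := ler_norm (- f i).
  rewrite normrN; lra.
- under eq_bigr do rewrite !scalerDl -scalerA.
  rewrite !big_split /= -scaler_sumr ex scaler0 add0r -fE.
  rewrite [X in _ + X](_ : _ = \sum_(i in ~: I) x i) ?addNr//.
  rewrite [RHS]big_mkcond /=; apply: eq_bigr => i _.
  by case: (i \in ~: I); rewrite ?scale1r ?scale0r.
Qed.

Variable k : nat.
Hypothesis kd : (k < d)%N.

(** Dividing the dependence by the scalars [l i] gives the values of an affine function on the
    points: a supporting hyperplane touching exactly those indexed by [I]. *)
Lemma coface_functional (I : {set 'I_N}) : coface I ->
  exists u b, (forall i, 0 <= b - dotmul u (a i)) /\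
    (forall i, (i \in I) = (b - dotmul u (a i) == 0)).
Proof.
move=> [c [cI cpos cx]].
have [|u [b ub]] := gale_affine_functional (fun i => c i / l i).
  rewrite -[RHS]cx; apply: eq_bigr => i _.
  by rewrite scalerA divfK// gt_eqF.
exists u, b; split=> i; rewrite -ub; have [iI|iI] := boolP (i \in I).
- by rewrite cI ?mul0r.
- by rewrite divr_ge0 ?ltW ?cpos.
- by rewrite cI ?mul0r ?eqxx.
- by rewrite gt_eqF// divr_gt0 ?cpos.
Qed.

(** A face is spanned by the points of zero slack. Slacks times [l] form a nonnegative dependence of
    the [x i] vanishing exactly at these indices, so they make up a coface; affine independence
    turns dimension into cardinality. *)
Lemma facesE :
  [set F | is_face (combos a [set: 'I_N]%SET) F /\ has_affine_dim F k] =
  combos a @` [set I : {set 'I_N} | #|I| = k.+1 /\ coface I].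
Proof.
apply/seteqP; split => [F [[u [b [Gu FE]]] dF]|_ [I [cI coI] <-]]; last first.
  have [u [b [h0 hI]]] := coface_functional _ coI.
  have [Gu FE] := supporting_combos a I u b h0 hI.
  split; first by exists u, b.
  apply/combos_affine_dim => //; apply: cofacet_affinely_independent.
  have := cardsC I; rewrite cI card_ord; move: (#|_|) => m; lia.
pose I := [set i | b - dotmul u (a i) == 0]%SET.
have h0 i : 0 <= b - dotmul u (a i).
  by rewrite subr_ge0; apply: Gu; apply: combos_mem; rewrite inE.
have hI i : (i \in I) = (b - dotmul u (a i) == 0) by rewrite inE.
have [_ FI] := supporting_combos a I u b h0 hI.
have FE' : F = combos a I by rewrite FI.
pose c i := (b - dotmul u (a i)) * l i.
have cx : \sum_i c i *: x i = 0.
  rewrite -[RHS](affine_functional_gale (fun i => b - dotmul u (a i)) u b)//.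
  by apply: eq_bigr => i _; rewrite scalerA.
have cn0 i : (c i != 0) = (i \notin I).
  by rewrite /c mulf_eq0 [X in _ || X]gt_eqF// orbF hI.
(* If every slack vanishes, the face is the whole polytope, of dimension [d] instead of [k]. *)
have [IT|IT] := eqVneq I [set: 'I_N]%SET.
  exfalso; have := @affine_hull_dim_full R d F k.
  rewrite FE' IT => /(_ _ _); rewrite -IT -FE' => E.
  suff : k = d by move=> kE; have := kd; rewrite kE ltnn.
  apply: E => //; apply/seteqP; split => // z _.
  have [aT _ _] := gale; have : affine_hull (range a) z by rewrite aT.
  apply: affine_hull_mono => _ [i _ <-]; rewrite FE'.
  by apply: combos_mem; rewrite IT inE.
have nI : (n <= #|~: I|)%N.
  apply: ltnW; rewrite (_ : ~: I = [set i | c i != 0]%SET); last first.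
    by apply/setP => i; rewrite finset.in_setC [RHS]inE cn0.
  apply: nonneg_dependence_support => //.
    by move=> i; rewrite mulr_ge0 ?h0// ltW.
  have : ~: I != finset.set0 by rewrite -finset.setCT (inj_eq (@finset.setC_inj _)).
  by case/set0Pn => i; rewrite finset.in_setC -cn0; exists i.
exists I => //; split.
  by apply/(combos_affine_dim a I) => //; [exact: cofacet_affinely_independent|rewrite -FE'].
exists c; split => // i iI.
  by apply/eqP; rewrite -[_ == _]negbK cn0 iI.
by rewrite lt_neqAle eq_sym cn0 iI /= /c mulr_ge0 ?h0// ltW.
Qed.

(** The hyperplane of [coface_functional] for [J] touches no point with index off [J], so a face
    determines its index set. *)
Lemma combos_coface_inj (I J : {set 'I_N}) : coface I -> coface J ->
  combos a I = combos a J -> I = J.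
Proof.
wlog suff : I J / coface J -> combos a I = combos a J -> I \subset J.
  move=> h cI cJ E; apply/eqP; rewrite finset.eqEsubset.
  by rewrite (h I J)// (h J I).
move=> cJ E; apply/fintype.subsetP => i iI.
have [u [b [h0 hJ]]] := coface_functional _ cJ.
have [_ FJ] := supporting_combos a J u b h0 hJ.
have : combos a J (a i) by rewrite -E; exact: combos_mem.
by rewrite FJ => -[_ /= ui]; rewrite hJ ui subrr.
Qed.

Lemma num_faces_gale : num_faces k (conv_hull (range a)) =
  (\sum_(I : {set 'I_N} | #|I| == k.+1) (`[< coface I >] : nat))%N.
Proof.
rewrite /num_faces conv_hull_combos facesE.
pose A := [set I : {set 'I_N} | (#|I| == k.+1) && `[< coface I >]]%SET.
have -> : [set I : {set 'I_N} | #|I| = k.+1 /\ coface I] = [set` [fset I in enum A]%fset].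
  apply/seteqP; split => I /=; rewrite !inE mem_enum inE.
    by move=> [/eqP -> /asboolT ->].
  by move=> /andP[/eqP ? /asboolP ?].
rewrite fset_set_image; last exact: finite_fset.
rewrite set_fsetK card_in_imfset; last first.
  move=> I J /=; rewrite !inE !mem_enum !inE => /andP[_ /asboolP cI] /andP[_ /asboolP cJ].
  exact: combos_coface_inj.
transitivity #|A|.
  by rewrite /= -[LHS]/(#|` [fset I in enum A]%fset|) card_fseq undup_id ?enum_uniq// -cardE.
rewrite -sum1_card big_mkcond [RHS]big_mkcond; apply: eq_bigr => I _.
by rewrite inE; case: (_ == _); case: `[< _ >].
Qed.

End GaleDuality.

(** * Binomial tails and their limits *)

Section BinomialTail.
Context {R : realType}.
Implicit Types (m j q : nat).

Definition binom_sum m j : nat := \sum_(i < m.+1 | (i <= j)%N) 'C(m, i).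

(* P(Bin(m, 1/2) <= j) *)
Definition binom_cdf m j : R := (binom_sum m j)%:R / 2 ^+ m.

Lemma binom_total m : (\sum_(i < m.+1) 'C(m, i))%N = (2 ^ m)%N.
Proof.
rewrite -[2%N]/(1 + 1)%N expnDn; apply: eq_bigr => i _.
by rewrite !exp1n !muln1.
Qed.

(** By symmetry of the binomial coefficients, the indices below [n] reflect to those above [j], so
    the two sums exhaust row [n + j] of Pascal's triangle. *)
Lemma schlafli_binom_sum n j :
  (schlafli n (n + j).+1 + 2 * binom_sum (n + j) j = 2 ^ (n + j).+1)%N.
Proof.
rewrite schlafliE -mulnDr expnS; congr (2 * _)%N.
rewrite -binom_total (bigID (fun i : 'I_(n + j).+1 => (i <= j)%N)) /= addnC.
congr (_ + _)%N.
rewrite [RHS](reindex_inj rev_ord_inj) /= (big_ord_widen (n + j).+1 (fun i => 'C(n + j, i))); last first.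
  by rewrite leqW// leq_addr.
rewrite big_mkcond [RHS]big_mkcond; apply: eq_bigr => i _.
have il := ltn_ord i; rewrite ltnS in il.
rewrite subSS bin_sub//; congr (if _ then _ else _).
by rewrite -ltnNge; lia.
Qed.

Lemma binom_sum_le m j : (binom_sum m j <= 2 ^ m)%N.
Proof.
by rewrite -binom_total /binom_sum big_mkcond; apply: leq_sum => i _; case: ifP.
Qed.

Lemma binom_sum_gt0 m j : (0 < binom_sum m j)%N.
Proof. by rewrite /binom_sum (bigD1 ord0)//= bin0. Qed.

Lemma binom_cdf_gt0 m j : 0 < binom_cdf m j.
Proof. by rewrite divr_gt0 ?ltr0n ?binom_sum_gt0// exprn_gt0. Qed.

Lemma binom_cdf_le1 m j : binom_cdf m j <= 1.
Proof.
by rewrite ler_pdivrMr ?exprn_gt0// mul1r -natrX ler_nat binom_sum_le.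
Qed.

Lemma binom_sumS m (f : nat -> R) :
  \sum_(i < m.+2) 'C(m.+1, i)%:R * f i = \sum_(i < m.+1) 'C(m, i)%:R * (f i + f i.+1).
Proof.
under [RHS]eq_bigr do rewrite mulrDr.
rewrite big_split /= big_ord_recl /= bin0.
under eq_bigr do rewrite /bump leq0n add1n binS natrD mulrDl.
rewrite big_split /= addrA; congr (_ + _).
rewrite big_ord_recr /= bin_small// mul0r addr0 [RHS]big_ord_recl /= bin0.
by congr (_ + _); apply: eq_bigr => i _; rewrite lift0.
Qed.

(* The shift t makes the second moment of a sum of m signs inductive in m. *)
Lemma binom_second_moment m (t : R) :
  \sum_(i < m.+1) 'C(m, i)%:R * (2 * i%:R - m%:R + t) ^+ 2 = (m%:R + t ^+ 2) * 2 ^+ m.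
Proof.
elim: m t => [|m ih] t.
  by rewrite big_ord1 bin0 /= mulr0n; ring.
rewrite (binom_sumS m (fun i => (2 * i%:R - m.+1%:R + t) ^+ 2)).
have := congr2 +%R (ih (t - 1)) (ih (t + 1)); rewrite -big_split /= => E.
transitivity ((m%:R + (t - 1) ^+ 2) * 2 ^+ m + (m%:R + (t + 1) ^+ 2) * 2 ^+ m).
  rewrite -E; apply: eq_bigr => i _; rewrite -mulrDr; congr (_ * (_ ^+ 2 + _ ^+ 2)).
    by rewrite -(natr1 m); ring.
  by rewrite -(natr1 m) -(natr1 i); ring.
by rewrite -mulrDl (exprS 2 m) mulrA -(natr1 m); congr (_ * _); ring.
Qed.

(** Chebyshev's inequality: [2 * i - m] is a sum of [m] fair signs, with second moment [m]. *)
Lemma chebyshev_sum m (Q : pred 'I_m.+1) (b : R) : 0 < b ->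
  (forall i, Q i -> b ^+ 2 <= (2 * i%:R - m%:R) ^+ 2) ->
  (\sum_(i < m.+1 | Q i) 'C(m, i))%:R / 2 ^+ m <= m%:R / b ^+ 2.
Proof.
move=> b0 Qb; rewrite ler_pdivlMr ?exprn_gt0// mulrAC ler_pdivrMr ?exprn_gt0//.
have := binom_second_moment m 0; rewrite expr0n addr0 => <-.
rewrite natr_sum mulr_suml big_mkcond /=; apply: ler_sum => i _.
case: ifP => [Qi|_]; last by rewrite mulr_ge0 ?ler0n ?sqr_ge0.
by rewrite ler_wpM2l ?ler0n// addr0 Qb.
Qed.

Lemma binom_cdf_upper m j : (2 * j < m)%N ->
  binom_cdf m j <= m%:R / (m%:R - 2 * j%:R) ^+ 2.
Proof.
move=> jm; have jm' : 2 * j%:R < m%:R :> R by rewrite -natrM ltr_nat.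
apply: chebyshev_sum; first by rewrite subr_gt0.
move=> i ij; have ij' : i%:R <= j%:R :> R by rewrite ler_nat.
rewrite -(sqrrN (_ - m%:R)) ler_sqr ?nnegrE; lra.
Qed.

Lemma binom_cdf_lower m j : (m < 2 * j)%N ->
  1 - m%:R / (m%:R - 2 * j%:R) ^+ 2 <= binom_cdf m j.
Proof.
move=> jm; have jm' : m%:R < 2 * j%:R :> R by rewrite -natrM ltr_nat.
rewrite lerBlDl -lerBlDr; apply: le_trans (_ : (\sum_(i < m.+1 | ~~ (i <= j)%N) 'C(m, i))%:R / 2 ^+ m <= _); last first.
  rewrite -(sqrrN (_ - _)); apply: chebyshev_sum; first by rewrite oppr_gt0; lra.
  move=> i; rewrite -ltnNge => ij; have ij' : j%:R < i%:R :> R by rewrite ltr_nat.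
  rewrite ler_sqr ?nnegrE; lra.
rewrite lerBlDr -mulrDl -natrD addnC (_ : (_ + _)%N = (2 ^ m)%N).
  by rewrite natrX divff// expf_neq0.
by rewrite -binom_total [RHS](bigID (fun i : 'I_m.+1 => (i <= j)%N)).
Qed.

(** For [i <= j], [m.+1 * 'C(m, i) = i.+1 * 'C(m.+1, i.+1)] is at most [j.+1 * 'C(m.+1, i.+1)];
    summing loses only the term of index 0. *)
Lemma binom_cdf_pred m j :
  binom_cdf m j <= 2 * j.+1%:R / m.+1%:R * binom_cdf m.+1 j.+1.
Proof.
have m0 : 0 < m.+1%:R :> R by rewrite ltr0n.
have p0 : 0 < 2 ^+ m :> R by exact: exprn_gt0.
have -> : 2 * j.+1%:R / m.+1%:R * binom_cdf m.+1 j.+1 =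
    (j.+1%:R * (binom_sum m.+1 j.+1)%:R / m.+1%:R) / 2 ^+ m :> R.
  by rewrite /binom_cdf exprS; field; rewrite gt_eqF//= gt_eqF.
rewrite {1}/binom_cdf ler_wpM2r ?invr_ge0 ?(ltW p0)// ler_pdivlMr// -!natrM ler_nat mulnC.
rewrite /binom_sum [X in (_ <= _ * X)%N]big_mkcond big_ord_recl /=.
apply: leq_trans (_ : (j.+1 * \sum_(i < m.+1 | (i <= j)%N) 'C(m.+1, i.+1) <= _)%N); last first.
  rewrite leq_mul2l/= [X in (X <= _)%N]big_mkcond; apply: leq_trans (leq_addl _ _).
  by apply: leq_sum => i _; rewrite /bump leq0n add1n ltnS.
rewrite !big_distrr /=; apply: leq_sum => i ij.
by rewrite mul_bin_diag leq_mul2r ltnS ij orbT.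
Qed.

Lemma binom_cdf_geom m j q : (q <= j)%N -> (j < m)%N ->
  binom_cdf (m - q) (j - q) <= (2 * j%:R / m%:R) ^+ q * binom_cdf m j.
Proof.
elim: q m j => [|q ih] m j; first by rewrite !subn0 expr0 mul1r.
case: j => // j; case: m => // m; rewrite !ltnS => qj jm; rewrite !subSS.
apply: le_trans (ih _ _ qj jm) _; rewrite exprSr -[leRHS]mulrA.
apply: le_trans (_ : (2 * j%:R / m%:R) ^+ q * (2 * j.+1%:R / m.+1%:R * binom_cdf m.+1 j.+1) <= _).
  by rewrite ler_wpM2l ?binom_cdf_pred.
rewrite ler_wpM2r//.
  by rewrite mulr_ge0 ?ltW ?binom_cdf_gt0// divr_gt0// mulr_gt0.
(* Since [j < m], lowering both by one decreases the ratio, so the initial ratio bounds all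
   factors. *)
rewrite lerXn2r ?nnegrE ?divr_ge0 ?mulr_ge0//.
have m0 : 0 < m%:R :> R by rewrite ltr0n; lia.
rewrite ler_pdivrMr// mulrAC ler_pdivlMr ?ltr0n// -!natrM ler_nat; lia.
Qed.

(** Two blocks are needed at [delta = 1/2]: there the initial ratio tends to 1, and only the ratio
    after [h] steps stays away from 1. *)
Lemma binom_cdf_geom2 m j h q : (h + q <= j)%N -> (j < m)%N ->
  binom_cdf (m - (h + q)) (j - (h + q)) <=
  (2 * j%:R / m%:R) ^+ h * (2 * (j - h)%:R / (m - h)%:R) ^+ q * binom_cdf m j.
Proof.
move=> hq jm; rewrite !subnDA.
apply: le_trans (binom_cdf_geom (m - h) (j - h) q _ _) _; [lia|lia|].
rewrite [in leRHS]mulrAC [leRHS]mulrC ler_wpM2l//.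
by apply: binom_cdf_geom => //; lia.
Qed.

End BinomialTail.

(** * Asymptotics of the normalised face number *)

Section Limits.
Context {R : realType}.
Implicit Types (m j k : nat -> nat) (a b : R).

Lemma cvg_invn : (d%:R^-1 : R) @[d --> \oo] --> (0 : R).
Proof.
apply/cvgrPdist_lt => e e0; near=> d.
have d0 : 0 < d%:R :> R by rewrite ltr0n; near: d; exact: nbhs_infty_gt.
rewrite sub0r normrN ger0_norm ?invr_ge0 ?ler0n// invf_plt ?posrE//.
near: d; exact: nbhs_infty_gtr.
Unshelve. all: by end_near. Qed.

Lemma cvg_chebyshev m j a b :
  ((m d)%:R / d%:R : R) @[d --> \oo] --> b ->
  ((j d)%:R / d%:R : R) @[d --> \oo] --> a -> b != 2 * a ->
  ((m d)%:R / ((m d)%:R - 2 * (j d)%:R) ^+ 2 : R) @[d --> \oo] --> (0 : R).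
Proof.
move=> mb ja ba.
have ba0 : (b - 2 * a) ^+ 2 != 0 by rewrite sqrf_eq0 subr_eq0.
have c1 : ((m d)%:R / d%:R - 2 * ((j d)%:R / d%:R) : R) @[d --> \oo] --> b - 2 * a.
  by apply: cvgB => //; apply: cvgM => //; exact: cvg_cst.
have : (d%:R^-1 * ((m d)%:R / d%:R / ((m d)%:R / d%:R - 2 * ((j d)%:R / d%:R)) ^+ 2) : R)
    @[d --> \oo] --> 0 * (b / (b - 2 * a) ^+ 2).
  apply: cvgM; first exact: cvg_invn.
  apply: cvgM => //; apply: cvgV => //.
  by rewrite expr2; under eq_fun do rewrite expr2; exact: cvgM.
rewrite mul0r; apply: cvg_trans; apply: near_eq_cvg; near=> d.
have d0 : d%:R != 0 :> R by rewrite pnatr_eq0 -lt0n; near: d; exact: nbhs_infty_gt.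
have h : (m d)%:R / d%:R - 2 * ((j d)%:R / d%:R) = ((m d)%:R - 2 * (j d)%:R) / d%:R :> R.
  by field.
rewrite h expr_div_n invf_div; move: (((m d)%:R - 2 * (j d)%:R) ^+ 2)^-1 => w.
by field.
Unshelve. all: by end_near. Qed.

Lemma near_double_lt m j a b :
  ((m d)%:R / d%:R : R) @[d --> \oo] --> b ->
  ((j d)%:R / d%:R : R) @[d --> \oo] --> a -> 2 * a < b ->
  \forall d \near \oo, (2 * j d < m d)%N.
Proof.
move=> mb ja ab.
have c1 : ((m d)%:R / d%:R - 2 * ((j d)%:R / d%:R) : R) @[d --> \oo] --> b - 2 * a.
  by apply: cvgB => //; apply: cvgM => //; exact: cvg_cst.
have : \forall d \near \oo, 0 < ((m d)%:R / d%:R - 2 * ((j d)%:R / d%:R) : R).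
  by apply: (cvgr_gt (b - 2 * a)) => //; rewrite subr_gt0.
move=> h; near=> d; have : 0 < ((m d)%:R / d%:R - 2 * ((j d)%:R / d%:R) : R).
  by near: d.
have d0 : 0 < d%:R :> R by rewrite ltr0n; near: d; exact: nbhs_infty_gt.
by rewrite subr_gt0 mulrA ltr_pM2r ?invr_gt0// -natrM ltr_nat.
Unshelve. all: by end_near. Qed.

Lemma near_double_gt m j a b :
  ((m d)%:R / d%:R : R) @[d --> \oo] --> b ->
  ((j d)%:R / d%:R : R) @[d --> \oo] --> a -> b < 2 * a ->
  \forall d \near \oo, (m d < 2 * j d)%N.
Proof.
move=> mb ja ab.
have c1 : (2 * ((j d)%:R / d%:R) - (m d)%:R / d%:R : R) @[d --> \oo] --> 2 * a - b.
  by apply: cvgB => //; apply: cvgM => //; exact: cvg_cst.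
have : \forall d \near \oo, 0 < (2 * ((j d)%:R / d%:R) - (m d)%:R / d%:R : R).
  by apply: (cvgr_gt (2 * a - b)) => //; rewrite subr_gt0.
move=> h; near=> d; have : 0 < (2 * ((j d)%:R / d%:R) - (m d)%:R / d%:R : R).
  by near: d.
have d0 : 0 < d%:R :> R by rewrite ltr0n; near: d; exact: nbhs_infty_gt.
by rewrite subr_gt0 mulrA ltr_pM2r ?invr_gt0// -natrM ltr_nat.
Unshelve. all: by end_near. Qed.

Lemma cvg_binom_cdf0 m j a b :
  ((m d)%:R / d%:R : R) @[d --> \oo] --> b ->
  ((j d)%:R / d%:R : R) @[d --> \oo] --> a -> 2 * a < b ->
  (binom_cdf (m d) (j d) : R) @[d --> \oo] --> (0 : R).
Proof.
move=> mb ja ab; apply: (squeeze_cvgr _ (cvg_cst 0)).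
  have h := near_double_lt _ _ _ _ mb ja ab.
  near=> d; rewrite ltW ?binom_cdf_gt0//=; apply: binom_cdf_upper.
  by near: d.
by apply: (cvg_chebyshev _ _ _ _ mb ja); rewrite gt_eqF.
Unshelve. all: by end_near. Qed.

Lemma cvg_binom_cdf1 m j a b :
  ((m d)%:R / d%:R : R) @[d --> \oo] --> b ->
  ((j d)%:R / d%:R : R) @[d --> \oo] --> a -> b < 2 * a ->
  (binom_cdf (m d) (j d) : R) @[d --> \oo] --> (1 : R).
Proof.
move=> mb ja ab.
have : (1 - (m d)%:R / ((m d)%:R - 2 * (j d)%:R) ^+ 2 : R) @[d --> \oo] --> (1 - 0 : R).
  apply: cvgB; first exact: cvg_cst.
  by apply: (cvg_chebyshev _ _ _ _ mb ja); rewrite lt_eqF.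
rewrite subr0 => c1; apply: (squeeze_cvgr _ c1 (cvg_cst (1 : R))).
have h := near_double_gt _ _ _ _ mb ja ab.
near=> d; rewrite binom_cdf_le1 andbT; apply: binom_cdf_lower.
by near: d.
Unshelve. all: by end_near. Qed.

Lemma uphalf_le (n : nat) : (uphalf n <= n)%N.
Proof. by rewrite leq_uphalf_double; lia. Qed.

Lemma uphalf_complement (n : nat) :
  (uphalf n <= n.+1 - uphalf n)%N /\ (uphalf n + (n.+1 - uphalf n) = n.+1)%N.
Proof. by have := odd_double_half n; rewrite uphalf_half; lia. Qed.

Lemma mulr_div_div (c x y D : R) : D != 0 -> c * x / y = c * (x / D) / (y / D).
Proof. by move=> D0; rewrite invf_div !mulrA divfK. Qed.

Lemma half_split (H O D : R) : (2 * H - O) / D / 2 + O / 2 * D^-1 = H / D.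
Proof.
have [->|D0] := eqVneq D 0; first by rewrite invr0 !mulr0 !mul0r addr0.
by field.
Qed.

Variables (delta rho : R) (k N : nat -> nat).
Hypotheses (hdelta : 0 < delta < 1) (hrho : 0 < rho < 1).
Hypothesis hkdN : forall d : nat, (0 < d)%N -> (k d < d)%N /\ (d < N d - 1)%N.
Hypothesis hN : (d%:R / (N d)%:R : R) @[d --> \oo] --> delta.
Hypothesis hk : ((k d)%:R / d%:R : R) @[d --> \oo] --> rho.

(** Quotient of the probabilities that the [N - k - 1] vectors off a [k.+1]-set, respectively all
    [N] vectors, are not one-sided. *)
Definition face_ratio d : R :=
  binom_cdf (N d - (k d).+2) (d - (k d).+1) / binom_cdf (N d).-1 d.

Lemma cvg_Nd : ((N d)%:R / d%:R : R) @[d --> \oo] --> delta^-1.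
Proof.
have d0 : delta != 0 by case/andP: hdelta => /lt0r_neq0.
have : ((d%:R / (N d)%:R)^-1 : R) @[d --> \oo] --> delta^-1 by exact: cvgV.
by under eq_fun do rewrite invf_div.
Unshelve. all: by end_near. Qed.

Lemma cvg_pred_N : ((N d).-1%:R / d%:R : R) @[d --> \oo] --> delta^-1.
Proof.
have : ((N d)%:R / d%:R - d%:R^-1 : R) @[d --> \oo] --> delta^-1 - 0.
  by apply: cvgB; [exact: cvg_Nd|exact: cvg_invn].
rewrite subr0; apply: cvg_trans; apply: near_eq_cvg; near=> d.
have d0 : (0 < d)%N by near: d; exact: nbhs_infty_gt.
have [_ dN] := hkdN d d0.
have -> : (N d)%:R = (N d).-1%:R + 1 :> R by rewrite natr1 prednK//; lia.
by rewrite mulrDl mul1r addrK.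
Unshelve. all: by end_near. Qed.

Lemma cvg_subk (c : nat) (u : nat -> nat) b :
  ((u d)%:R / d%:R : R) @[d --> \oo] --> b ->
  (forall d, (0 < d)%N -> (k d + c <= u d)%N) ->
  ((u d - (k d + c))%:R / d%:R : R) @[d --> \oo] --> b - rho.
Proof.
move=> ub kcu.
have : ((u d)%:R / d%:R - (k d)%:R / d%:R - c%:R * d%:R^-1 : R) @[d --> \oo] --> b - rho - c%:R * 0.
  by apply: cvgB; [exact: cvgB|apply: cvgM; [exact: cvg_cst|exact: cvg_invn]].
rewrite mulr0 subr0; apply: cvg_trans; apply: near_eq_cvg; near=> d.
have d0 : (0 < d)%N by near: d; exact: nbhs_infty_gt.
by rewrite natrB ?kcu// natrD -!mulrBl opprD addrA.
Unshelve. all: by end_near. Qed.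

Lemma cvg_dd : (d%:R / d%:R : R) @[d --> \oo] --> (1 : R).
Proof.
apply: (@cvg_trans _ ((fun=> 1 : R) @ \oo)); last exact: cvg_cst.
apply: near_eq_cvg; near=> d.
rewrite divff// pnatr_eq0 -lt0n; near: d; exact: nbhs_infty_gt.
Unshelve. all: by end_near. Qed.

Let cvg_m : ((N d - (k d).+2)%:R / d%:R : R) @[d --> \oo] --> delta^-1 - rho.
Proof.
have := cvg_subk 2 N _ cvg_Nd; under eq_fun do rewrite addn2.
by apply => d d0; have [] := hkdN d d0; lia.
Qed.

Let cvg_j : ((d - (k d).+1)%:R / d%:R : R) @[d --> \oo] --> 1 - rho.
Proof.
have := cvg_subk 1 id _ cvg_dd; under eq_fun do rewrite addn1.
by apply => d d0; have [] := hkdN d d0; lia.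
Qed.

(** Since [rho] is positive, the hypothesis means [rho < 2 - delta^-1], which puts both thresholds
    above the mean of their binomial law. *)
Lemma cvg_face_ratio1 : rho < rho_W delta -> face_ratio d @[d --> \oo] --> (1 : R).
Proof.
move=> h; have {}h : rho < 2 - delta^-1.
  by move: h; rewrite /rho_W lt_max => /orP[|//]; case/andP: hrho; lra.
rewrite -[X in _ --> X]divr1; apply: cvgM.
  by apply: (cvg_binom_cdf1 _ _ _ _ cvg_m cvg_j); lra.
apply: cvgV => //.
apply: (cvg_binom_cdf1 _ _ _ _ cvg_pred_N cvg_dd).
by case/andP: hrho; lra.
Qed.

Lemma cvg_half : ((uphalf (k d))%:R / d%:R : R) @[d --> \oo] --> rho / 2.
Proof.
have : ((k d)%:R / d%:R / 2 + (odd (k d))%:R / 2 * d%:R^-1 : R) @[d --> \oo] --> rho / 2 + 0.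
  apply: cvgD; first by apply: cvgM => //; exact: cvg_cst.
  apply: (squeeze_cvgr _ (cvg_cst 0) cvg_invn); near=> d.
  rewrite mulr_ge0 ?invr_ge0 ?divr_ge0 ?ler0n//=.
  rewrite ler_piMl ?invr_ge0 ?ler0n//.
  by case: (odd _) => /=; lra.
rewrite addr0; apply: cvg_trans; apply: near_eq_cvg; near=> d.
have E : (k d + odd (k d) = 2 * uphalf (k d))%N.
  by have := odd_double_half (k d); rewrite uphalf_half; lia.
have {E} -> : (k d)%:R = 2 * (uphalf (k d))%:R - (odd (k d))%:R :> R.
  by rewrite -natrM -E natrD addrK.
exact: half_split.
Unshelve. all: by end_near. Qed.

(** The first [uphalf k] factors of the geometric bound have limiting ratio [al <= 1], the remaining
    ones [be < 1]. *)
Lemma cvg_face_ratio0_small : delta^-1 >= 2 -> face_ratio d @[d --> \oo] --> (0 : R).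
Proof.
move=> h2; pose M d := (N d).-1; pose h d := uphalf (k d).
case/andP: hrho => r0 r1.
have cM : ((M d - h d)%:R / d%:R : R) @[d --> \oo] --> delta^-1 - rho / 2.
  have : ((M d)%:R / d%:R - (h d)%:R / d%:R : R) @[d --> \oo] --> delta^-1 - rho / 2.
    by apply: cvgB; [exact: cvg_pred_N|exact: cvg_half].
  apply: cvg_trans; apply: near_eq_cvg; near=> d.
  have d0 : (0 < d)%N by near: d; exact: nbhs_infty_gt.
  have := uphalf_le (k d); have [] := hkdN d d0 => ? ? ?.
  by rewrite natrB ?mulrBl// /M /h; lia.
have cJ : ((d - h d)%:R / d%:R : R) @[d --> \oo] --> 1 - rho / 2.
  have : (d%:R / d%:R - (h d)%:R / d%:R : R) @[d --> \oo] --> 1 - rho / 2.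
    by apply: cvgB; [exact: cvg_dd|exact: cvg_half].
  apply: cvg_trans; apply: near_eq_cvg; near=> d.
  have d0 : (0 < d)%N by near: d; exact: nbhs_infty_gt.
  have := uphalf_le (k d); have [] := hkdN d d0 => ? ? ?.
  by rewrite natrB ?mulrBl// /h; lia.
pose A d : R := 2 * (d%:R / d%:R) / ((M d)%:R / d%:R).
pose B d : R := 2 * ((d - h d)%:R / d%:R) / ((M d - h d)%:R / d%:R).
pose al : R := 2 * 1 / delta^-1.
pose be : R := 2 * (1 - rho / 2) / (delta^-1 - rho / 2).
have cA : A d @[d --> \oo] --> al.
  apply: cvgM; first by apply: cvgM; [exact: cvg_cst|exact: cvg_dd].
  by apply: cvgV; [lra|exact: cvg_pred_N].
have cB : B d @[d --> \oo] --> be.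
  apply: cvgM; first by apply: cvgM; [exact: cvg_cst|exact: cJ].
  by apply: cvgV; [lra|exact: cM].
have be1 : be < 1 by rewrite ltr_pdivrMr; lra.
have be0 : 0 < be by rewrite divr_gt0; lra.
have al1 : al <= 1 by rewrite ler_pdivrMr; lra.
have al0 : 0 <= al by rewrite divr_ge0; lra.
have cAB : A d * B d @[d --> \oo] --> al * be by exact: cvgM.
have abbe : al * be <= be by rewrite ler_piMl ?(ltW be0).
(* The midpoint of [be] and 1 eventually bounds [A d * B d], whose limit is at most [be]. *)
pose c := (1 + be) / 2.
have c1 : c < 1 by rewrite /c; lra.
have c0 : 0 < c by rewrite /c; lra.
have nAB : \forall d \near \oo, A d * B d < c.
  by apply: (cvgr_lt (al * be)) => //; rewrite /c; lra.
have nB : \forall d \near \oo, B d < 1 by apply: (cvgr_lt be).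
have hoo : h d @[d --> \oo] --> \oo.
  have r4 : 0 < rho / 4 by lra.
  apply/cvgnyPge => K.
  have nh : \forall d \near \oo, rho / 4 < ((h d)%:R / d%:R : R).
    by apply: (cvgr_gt (rho / 2)); [exact: cvg_half|lra].
  near=> d; have d0 : 0 < d%:R :> R by rewrite ltr0n; near: d; exact: nbhs_infty_gt.
  have : rho / 4 < ((h d)%:R / d%:R : R) by near: d.
  rewrite ltr_pdivlMr// => hd; rewrite -(ler_nat R); apply: le_trans (ltW hd).
  rewrite -ler_pdivrMl//.
  by near: d; exact: nbhs_infty_ger.
have cch : c ^+ h d @[d --> \oo] --> (0 : R).
  by apply: (cvg_comp _ _ hoo); apply: cvg_expr; rewrite ger0_norm ?ltW.
apply: (squeeze_cvgr _ (cvg_cst 0) cch); near=> d.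
have d0 : (0 < d)%N by near: d; exact: nbhs_infty_gt.
have d0' : d%:R != 0 :> R by rewrite pnatr_eq0 -lt0n.
have nAd : A d * B d < c by near: d.
have nBd : B d < 1 by near: d.
have [kd dN] := hkdN d d0; have hkd := uphalf_le (k d).
rewrite /face_ratio divr_ge0 ?(ltW (binom_cdf_gt0 _ _))//=.
rewrite ler_pdivrMr ?binom_cdf_gt0//.
(* The second block has at least [h d] factors: pairing it with the first gives
   [(A d * B d) ^+ h d], and the leftover powers of [B d] are at most 1. *)
pose q := ((k d).+1 - h d)%N.
have [hq hqE] := uphalf_complement (k d); rewrite -/(h d) -/q in hq hqE.
have -> : (N d - (k d).+2 = M d - (h d + q))%N.
  by rewrite hqE /M -subn1 -subnDA.
have -> : (d - (k d).+1 = d - (h d + q))%N by rewrite hqE.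
apply: le_trans (binom_cdf_geom2 (M d) d (h d) q _ _) _.
- by rewrite hqE.
- by rewrite /M -subn1.
apply: ler_wpM2r; first exact/ltW/binom_cdf_gt0.
have AE : 2 * d%:R / (M d)%:R = A d.
  exact: mulr_div_div.
have BE : 2 * (d - h d)%:R / (M d - h d)%:R = B d.
  exact: mulr_div_div.
rewrite AE BE -(subnKC hq) exprD mulrA -exprMn.
have A0 : 0 <= A d by rewrite -AE divr_ge0// mulr_ge0.
have B0 : 0 <= B d by rewrite -BE divr_ge0// mulr_ge0.
apply: (@le_trans _ _ ((A d * B d) ^+ h d)).
  by rewrite ler_piMr ?exprn_ge0 ?mulr_ge0// exprn_ile1 ?(ltW nBd).
apply: lerXn2r; rewrite ?nnegrE; [exact: mulr_ge0|exact: ltW|exact: ltW].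
Unshelve. all: by end_near. Qed.

(** For [delta > 1/2] the denominator tends to 1, while the numerator's threshold is below its
    mean. *)
Lemma cvg_face_ratio0 : rho_W delta < rho -> face_ratio d @[d --> \oo] --> (0 : R).
Proof.
rewrite /rho_W gt_max => /andP[_ h].
have [h2|h2] := leP 2 delta^-1; first exact: cvg_face_ratio0_small.
rewrite -[X in _ --> X](mul0r 1^-1); apply: cvgM.
  by apply: (cvg_binom_cdf0 _ _ _ _ cvg_m cvg_j); lra.
by apply: cvgV => //; apply: (cvg_binom_cdf1 _ _ _ _ cvg_pred_N cvg_dd); lra.
Qed.

End Limits.

(** * The expected number of faces *)

Section NonmeasurableIntegral.
Context {d : measure_display} {T : measurableType d} {R : realType}.
Variable mu : {measure set T -> \bar R}.
Implicit Types f g : T -> \bar R.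

(** Monotonicity comes from the definition as a supremum over simple functions below, so neither
    side has to be measurable. *)
Lemma le_integral_nonmeasurable f g : (forall x, 0 <= f x)%E ->
  (forall x, f x <= g x)%E -> (\int[mu]_x f x <= \int[mu]_x g x)%E.
Proof.
move=> f0 fg; have g0 x : (0 <= g x)%E by exact: le_trans (fg x).
rewrite !ge0_integralTE//; apply: ereal_sup_le => _ [h /= hf <-].
by exists h => //= x; exact: le_trans (hf x) (fg x).
Qed.

(* f need not be measurable: the integral of a nonnegative function is a supremum
   over the simple functions below it, so f is squeezed between g set to 0 and g
   set to +oo on a measurable null set. *)
Lemma ae_eq_integral_nonmeasurable f g : (forall x, 0 <= f x)%E ->
  (forall x, 0 <= g x)%E -> measurable_fun setT g ->
  {ae mu, forall x, f x = g x} -> (\int[mu]_x f x = \int[mu]_x g x)%E.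
Proof.
move=> f0 g0 mg [A [mA A0 fgA]].
have fg x : ~ A x -> f x = g x.
  by move=> nA; apply: contrapT => h; apply: nA; exact: fgA.
have bound (c : \bar R) : (0 <= c)%E ->
    (\int[mu]_x (if x \in A then c else g x) = \int[mu]_x g x)%E.
  move=> c0; apply: ge0_ae_eq_integral => //.
  - apply: measurable_fun_ifT => //.
    apply: (measurable_fun_bool true); rewrite setTI (_ : _ @^-1` _ = A)//.
    by apply/seteqP; split=> x /=; [exact: set_mem|exact: mem_set].
  - by move=> x _; case: ifP.
  exists A; split => // x /= h; apply: contrapT => nA; apply: h => _.
  by rewrite ifF//; apply/negbTE/negP => /set_mem.
apply/eqP; rewrite eq_le; apply/andP; split.
  rewrite -(bound +oo%E)//; apply: le_integral_nonmeasurable => // x.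
  by case: ifPn => [_|]; [rewrite leey|move/negP => nA; rewrite fg// => /mem_set].
rewrite -(bound 0%E)//; apply: le_integral_nonmeasurable => x.
  by case: ifP.
by case: ifPn => // /negP nA; rewrite fg// => /mem_set.
Qed.

End NonmeasurableIntegral.

(** * From the conditional law of the diagram to the expected face count *)

Section FaceExpectation.
Context {R : realType}.

(** Gordan's alternative for the whole tuple, with the coefficients normalised to sum 1. *)
Lemma origin_in_convE N n :
  @origin_in_conv R N n = ~` one_sided (enum 'I_N).
Proof.
apply/seteqP; split => y; rewrite /origin_in_conv /= conv_hull_combos.
  move=> [c [c0 c1 _ E]] [u up].
  have := dotmul0r u; rewrite E dotmul_sumr => h.
  have pos i : 0 <= dotmul u (c i *: tnth y i).
    by rewrite dotmulZr mulr_ge0// ltW// up// mem_enum.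
  have cz i : c i = 0.
    have /eqP := psumr_eq0_all _ pos h i.
    rewrite dotmulZr mulf_eq0 [X in _ || X]gt_eqF ?orbF ?up ?mem_enum//.
    by move/eqP.
  by move/eqP: c1; rewrite big1 ?(eq_sym 0) ?oner_eq0.
move=> nside; have [|] := gordan (tnth y) (enum 'I_N) (enum_uniq _).
  by move=> side; case: nside.
move=> [c [c0 [i0 _ ci0] cy]].
pose S := \sum_i c i.
have S0 : 0 < S.
  by rewrite /S (bigD1 i0)//= ltr_pwDl//; apply: sumr_ge0.
exists (fun i => c i / S); split.
- by move=> i; rewrite divr_ge0// ltW.
- by rewrite -mulr_suml divff// gt_eqF.
- by move=> i; rewrite inE.
- under eq_bigr do rewrite mulrC -scalerA.
  rewrite -scaler_sumr; move: cy; rewrite big_enum /= => ->.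
  by rewrite scaler0.
Qed.

Lemma one_sidedS N n (s t : seq 'I_N) : {subset s <= t} ->
  @one_sided R n N t `<=` one_sided s.
Proof. by move=> st y [u up]; exists u => i si; apply: up; exact: st. Qed.

Context {n d N k : nat}.
Hypothesis Nnd : N = (n + d).+1.
Hypothesis kd : (k < d)%N.
Local Notation V := 'rV[R]_n.
Variable phi : probability V R.
Hypothesis phi_even : even_measure phi.
Hypothesis phi0 : null_on_linear_hyperplanes phi.

Let nN : (n <= N)%N. Proof. by rewrite Nnd -addnS leq_addr. Qed.

Lemma wendel_complement (mu : probability (N.-tuple V) R) (js : seq 'I_N) j :
  (forall B, (forall i, measurable (B i)) ->
    mu (box B) = (\prod_(i < N) phi (B i))%E) ->
  uniq js -> size js = (n + j).+1 ->
  mu (~` one_sided js) = (binom_cdf (n + j) j)%:E.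
Proof.
move=> mu_box ujs sj; rewrite probability_setC; last exact: measurable_one_sided.
rewrite (wendel phi mu mu_box phi_even phi0 js nN ujs) sj.
rewrite -EFinB; congr EFin; rewrite /binom_cdf.
have p0 : (2 ^ (n + j).+1)%:R != 0 :> R by rewrite pnatr_eq0 expn_eq0.
rewrite -[X in X - _](divff p0) -mulrBl -{1}(schlafli_binom_sum n j).
rewrite natrD addrAC subrr add0r natrM expnS natrM natrX.
by rewrite -mulf_div divff ?mul1r// pnatr_eq0.
Qed.

Context {d0 : measure_display} {T : measurableType d0}.
Variables (P : probability T R) (X : {RV P >-> N.-tuple V}).
Hypothesis hX : is_random_gale_diagram phi X.

(** Replaces the auxiliary i.i.d. sequence by its law [mu] on tuples, to which Wendel's theorem
    applies. *)
Lemma gale_diagram_law : exists mu : probability (N.-tuple V) R,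
  (forall B, (forall i, measurable (B i)) ->
    mu (box B) = (\prod_(i < N) phi (B i))%E) /\
  (forall A, measurable A -> P (X @^-1` A) =
    (mu (A `&` @origin_in_conv R N n) / mu (@origin_in_conv R N n))%E).
Proof.
have [d' [T' [P' [Y [indep lawY lawX]]]]] := hX.
pose Yseq t := [tuple Y i t | i < N].
have mY : measurable_fun setT Yseq.
  apply/measurable_fun_tnthP => i.
  rewrite [X in measurable_fun _ X](_ : _ = (Y i : T' -> V))//.
  by apply/funext => t /=; rewrite tnth_mktuple.
pose Yrv : {mfun T' >-> N.-tuple V} := mfun_Sub (mem_set mY).
have YE : (Yrv : T' -> N.-tuple V) = Yseq by exact: mfun_valP.
have YseqE C : distribution P' Yrv C = P' (Yseq @^-1` C).
  by rewrite -YE.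
exists (distribution P' Yrv); split; last first.
  move=> A mA; rewrite [X in (X / _)%E]YseqE [X in (_ / X)%E]YseqE.
  exact: (lawX A mA).
move=> B mB; rewrite [LHS]YseqE.
have := indep [set: 'I_N]%SET B mB.
rewrite (_ : \bigcap_(i in _) _ = Yseq @^-1` box B).
  move=> ->; rewrite (eq_bigl predT); last by move=> i; rewrite inE.
  by apply: eq_bigr => i _; exact: lawY.
apply/seteqP; split => t /= h i.
  by rewrite tnth_mktuple; apply: h; rewrite /= inE.
by move=> _; have := h i; rewrite tnth_mktuple.
Qed.

Local Notation face_prob :=
  (binom_cdf (N - k.+2) (d - k.+1) / binom_cdf N.-1 d : R).

(** If the vectors off [I] are not one-sided then neither is the whole tuple, so the event lies
    inside the conditioning event and its probability is a plain quotient. *)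
Lemma prob_coface (I : {set 'I_N}) : #|I| = k.+1 ->
  P (X @^-1` (~` one_sided (enum (~: I)))) = face_prob%:E.
Proof.
move=> cI; have [mu [mu_box ->]] := gale_diagram_law; last first.
  by apply: measurableC; exact: measurable_one_sided.
have cN : size (enum (~: I)) = (n + (d - k.+1)).+1.
  by rewrite -cardE; have := cardsC I; rewrite cI card_ord; move: (#|_|) => m; lia.
rewrite origin_in_convE setIidl; last first.
  by apply: subsetC; apply: one_sidedS => i _; rewrite mem_enum.
rewrite (wendel_complement mu _ (d - k.+1))//; last exact: enum_uniq.
rewrite (wendel_complement mu _ d)//; [|exact: enum_uniq|by rewrite size_enum_ord].
rewrite inver gt_eqF ?binom_cdf_gt0// -EFinM Nnd.
by congr (binom_cdf _ _ / _)%:E; lia.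
Qed.

Lemma gale_diagram_degenerate : P (X @^-1` degenerate) = 0%E.
Proof.
have [mu [mu_box ->]] := gale_diagram_law; last exact: measurable_degenerate.
rewrite (_ : mu (_ `&` _) = 0%E) ?mul0e//.
apply: (subset_measure0 (B := degenerate)) => //.
- apply: measurableI; first exact: measurable_degenerate.
  rewrite origin_in_convE; apply: measurableC; exact: measurable_one_sided.
- exact: measurable_degenerate.
- exact: degenerate_null mu_box phi0.
Qed.

Variable G : T -> set 'rV[R]_d.
Hypothesis hG : {ae P, forall t, is_gale_polytope (X t) (G t)}.

(** By linearity the expectation is a sum over the ['C(N, k.+1)] index sets, all with the same
    probability of being a coface. *)
Lemma expected_num_faces :
  ('E_P[fun t => (num_faces k (G t))%:R] / ('C(N, k.+1)%:R)%:E)%E = face_prob%:E.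
Proof.
pose A (I : {set 'I_N}) := X @^-1` (~` one_sided (enum (~: I))).
have mA I : measurable (A I).
  rewrite -[A I]setTI; apply: (measurable_funPT X) => //.
  by apply: measurableC; exact: measurable_one_sided.
pose D := [set I : {set 'I_N} | #|I| == k.+1]%SET.
pose g (t : T) : \bar R := (\sum_(I in D) (\1_(A I) t)%:E)%E.
have mI I : measurable_fun setT (fun t => (\1_(A I) t)%:E : \bar R).
  by apply/measurable_EFinP; apply: measurable_indic; exact: mA.
have gE : g = fun t => (\sum_(I <- enum D) (\1_(A I) t)%:E)%E.
  by apply/funext => t; rewrite big_enum.
have intg : (\int[P]_t g t)%E = ('C(N, k.+1)%:R * face_prob)%:E.
  rewrite gE ge0_integral_sum//.
  rewrite big_enum /= (eq_bigr (fun=> face_prob%:E)); last first.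
    move=> I; rewrite inE => /eqP cI; rewrite integral_indic// setIT; exact: prob_coface.
  rewrite sumEFin sumr_const mulr_natl; congr (_ *+ _)%:E.
  by rewrite -[in RHS](card_ord N) -card_draws.
(* [G] is an arbitrary choice of polytopes, so the face count is not assumed measurable; almost
   surely it equals the measurable [g]. *)
rewrite unlock (ae_eq_integral_nonmeasurable P _ g); first last.
- have : {ae P, forall t, ~ degenerate (X t)}.
    exists (X @^-1` degenerate); split.
    + rewrite -[X in measurable X]setTI; apply: (measurable_funPT X) => //.
      exact: measurable_degenerate.
    + exact: gale_diagram_degenerate.
    + by move=> t /= /contrapT.
  move: hG; apply: filterS2 => t [l [a [l0 _ gale ->]]] /contrapT gx.
  rewrite (num_faces_gale Nnd _ l a gx l0 gale k kd) natr_sum -sumEFin.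
  rewrite (eq_bigl (fun I => I \in D)); last by move=> I; rewrite [RHS]inE.
  apply: eq_bigr => I; rewrite inE => /eqP cI; rewrite indicE.
  congr (nat_of_bool _)%:R%:E; have IN : (#|I| < N)%N by rewrite cI Nnd; lia.
  have cof := coface_one_sided Nnd _ gx I IN.
  apply/asboolP/idP => [/cof h|/set_mem h].
    apply/mem_set => -[u up]; apply: h; exists u => i iI; apply: up.
    by rewrite mem_enum.
  apply/cof => -[u up]; apply: h; exists u => i; rewrite mem_enum; exact: up.
- by rewrite gE; apply: emeasurable_sum.
- by move=> t; apply: sume_ge0 => I _; rewrite lee_fin.
- by move=> t; rewrite lee_fin.
have C0 : 'C(N, k.+1)%:R != 0 :> R.
  by rewrite pnatr_eq0 -lt0n bin_gt0 Nnd; lia.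
by rewrite intg inver (negbTE C0) -EFinM mulrAC divff// mul1r.
Qed.

End FaceExpectation.

Theorem theorem2 (R : realType) (delta rho : R)
  (hdelta : 0 < delta < 1) (hrho : 0 < rho < 1)
  (k N : nat -> nat)
  (hkdN : forall d : nat, (0 < d)%N -> (k d < d)%N /\ (d < N d - 1)%N)
  (hN : (d%:R / (N d)%:R : R) @[d --> \oo] --> delta)
  (hk : ((k d)%:R / d%:R : R) @[d --> \oo] --> rho)
  (phi : forall d : nat, probability 'rV[R]_(N d - d - 1) R)
  (phi_even : forall d : nat, (0 < d)%N -> even_measure (phi d))
  (phi_hyp : forall d : nat, (0 < d)%N -> null_on_linear_hyperplanes (phi d))
  (disp : nat -> measure_display)
  (T : forall d : nat, measurableType (disp d))
  (P : forall d : nat, probability (T d) R)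
  (X : forall d : nat, {RV (P d) >-> (N d).-tuple 'rV[R]_(N d - d - 1)})
  (hX : forall d : nat, (0 < d)%N -> is_random_gale_diagram (phi d) (X d))
  (G : forall d : nat, T d -> set 'rV[R]_d)
  (hG : forall d : nat, (0 < d)%N ->
    {ae P d, forall t, is_gale_polytope (X d t) (G d t)}) :
  let ratio (d : nat) : \bar R :=
    ('E_(P d)[fun t => (num_faces (k d) (G d t))%:R] /
       ('C(N d, (k d).+1)%:R)%:E)%E in
  (rho < rho_W delta -> ratio d @[d --> \oo] --> 1%E) /\
  (rho_W delta < rho -> ratio d @[d --> \oo] --> 0%E).
Proof.
move=> ratio.
have ratioE : \forall d \near \oo, (face_ratio k N d : R)%:E = ratio d.
  near=> d; have d0 : (0 < d)%N by near: d; exact: nbhs_infty_gt.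
  have [kd dN] := hkdN d d0.
  (* The truncated subtractions are exact because [d < N d - 1], which holds only from [d = 1]
     on. *)
  have Nnd : N d = ((N d - d - 1) + d).+1 by lia.
  apply/esym.
  exact: (expected_num_faces Nnd kd (phi d) (phi_even d d0) (phi_hyp d d0)
    (P d) (X d) (hX d d0) (G d) (hG d d0)).
have lim (l : R) : face_ratio k N d @[d --> \oo] --> l -> ratio d @[d --> \oo] --> l%:E.
  move=> cl; apply: (cvg_trans (near_eq_cvg ratioE)).
  apply: (@cvg_EFin _ _ \oo _ (fun d => (face_ratio k N d)%:E)); last exact: cl.
  by apply: nearW => d.
split=> h; apply: lim.
  exact: (cvg_face_ratio1 delta rho k N hdelta hrho hkdN hN hk h).
exact: (cvg_face_ratio0 delta rho k N hdelta hrho hkdN hN hk h).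
Unshelve. all: by end_near. Qed.
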